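(* Under Assumptions 1-MP, 2-MP (a),(b),(c), 3-MP and Parallel Trends 4-MP(a), and assuming that for each $g\le\mathcal{T}$ and each window $A$ below the map $(a,b)\mapsto\overline{ATT}^A(g,a|g,b)$ is differentiable on $\mathcal{D}_+\times\mathcal{D}_+$, for all $g,k\in\mathcal{G}\setminus\{\mathcal{T}+1\}$ with $k>g$: $$\delta^{WITHIN}(g)=\int_{\mathcal{D}_+}w_1^{within}(g,l)\Big(\overline{ACRT}^{POST(g)}(g,l|g,l)+\frac{\partial\overline{ATT}^{POST(g)}(g,l|g,h)}{\partial h}\Big|_{h=l}\Big)dl,$$ $$\delta^{MID,PRE}(g,k)=\int_{\mathcal{D}_+}w_1(g,l)\Big(\overline{ACRT}^{MID(g,k)}(g,l|g,l)+\frac{\partial\overline{ATT}^{MID(g,k)}(g,l|g,h)}{\partial h}\Big|_{h=l}\Big)dl+w_0(g)\frac{\overline{ATT}^{MID(g,k)}(g,d_L|g,d_L)}{d_L},$$ $$\delta^{POST,MID}(g,k)=\int_{\mathcal{D}_+}w_1(k,l)\Big(\overline{ACRT}^{POST(k)}(k,l|k,l)+\frac{\partial\overline{ATT}^{POST(k)}(k,l|k,h)}{\partial h}\Big|_{h=l}\Big)dl+w_0(k)\frac{\overline{ATT}^{POST(k)}(k,d_L|k,d_L)}{d_L}-w_0(k)\frac{\pi^{POST(k),PRE(g)}(g)-\pi^{MID(g,k),PRE(g)}(g)}{d_L},$$ and, when $\mathbb{E}[D\mid G=g]\ne\mathbb{E}[D\mid G=k]$, $$\delta^{POST,PRE}(g,k)=\int_{\mathcal{D}_+}w_1^{across}(g,k,l)\Big(\overline{ACRT}^{POST(k)}(g,l|g,l)+\frac{\partial\overline{ATT}^{POST(k)}(g,l|g,h)}{\partial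 h}\Big|_{h=l}\Big)dl-\Big\{\int_{\mathcal{D}_+}\tilde w_1^{across}(g,k,l)\Big(\frac{\partial\pi_D^{POST(k),PRE(g)}(k,l)}{\partial l}-\frac{\partial\pi_D^{POST(k),PRE(g)}(g,l)}{\partial l}\Big)dl+\tilde w_0^{across}(g,k)\frac{\pi_D^{POST(k),PRE(g)}(k,d_L)-\pi_D^{POST(k),PRE(g)}(g,d_L)}{d_L}\Big\}.$$
   Context: Multi-period setup. Periods $t=1,\dots,\mathcal{T}$. Each unit has a timing group $G\in\mathcal{G}\subseteq\{2,\dots,\mathcal{T}+1\}$ ($G=\mathcal{T}+1$ means never treated) and a dose $D\ge0$, with $D=0$ exactly for never-treated units and $D\in\mathcal{D}_+$ for units with $G\le\mathcal{T}$. Potential outcomes $Y_t(g,d)$; $Y_t(0):=Y_t(\mathcal{T}+1,0)$. $W_t:=D\mathbf{1}\{t\ge G\}$. Observed $Y_t=Y_t(0)\mathbf{1}\{t<G\}+Y_t(G,D)\mathbf{1}\{t\ge G\}$; finite second moments. 1-MP: i.i.d. sampling of $(Y_1,\dots,Y_{\mathcal{T}},D,G)$. 2-MP: (a) support of $D$ is $\{0\}\cup\mathcal{D}_+$, $\mathbb{P}(D=0)>0$, every $d\in\mathcal{D}_+$ in the support of $D\mid G=g$ for $g\le\mathcal{T}$; (b) $\mathcal{D}_+=[d_L,d_U]$, $0<d_L<d_U<\infty$; (c) $d\mapsto\mathbb{E}[\Delta Y_t\mid G=g,D=d]$ continuously differentiable on $\mathcal{D}_+$. 3-MP: (a) $Y_t(g,d)=Y_t(0)$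 for $t<g$; (b) $W_1=0$, $W_{t-1}=d\Rightarrow W_t=d$. 4-MP(a): for all $g\in\mathcal{G}$, $t=2,\dots,\mathcal{T}$, $d\in\mathcal{D}$: $\mathbb{E}[Y_t(0)-Y_{t-1}(0)\mid G=g,D=d]=\mathbb{E}[Y_t(0)-Y_{t-1}(0)\mid D=0]$. Parameters: for window $A=(t_1,t_2)$, $\overline{ATT}^A(g,a|g,b):=\mathbb{E}\big[\frac1{t_2-t_1+1}\sum_{t=t_1}^{t_2}(Y_t(g,a)-Y_t(0))\mid G=g,D=b\big]$; $\overline{ACRT}^A(g,d|g,d):=\frac{\partial\overline{ATT}^A(g,l|g,d)}{\partial l}\big|_{l=d}$. Notation: $\bar Y^{(t_1,t_2)}:=\frac1{t_2-t_1+1}\sum_{t=t_1}^{t_2}Y_t$; $PRE(g)=(1,g-1)$, $MID(g,k)=(g,k-1)$, $POST(k)=(k,\mathcal{T})$, $\bar Y^A$ average over window $A$. $\pi_D^{A,B}(g,d):=\mathbb{E}[\bar Y^A-\bar Y^B\mid G=g,D=d]-\mathbb{E}[\bar Y^A-\bar Y^B\mid D=0]$; $\pi^{A,B}(g):=\mathbb{E}[\bar Y^A-\bar Y^B\mid G=g]-\mathbb{E}[\bar Y^A-\bar Y^B\mid D=0]$. Comparisons: $\delta^{WITHIN}(g):=\mathrm{cov}(\bar Y^{POST(g)}-\bar Y^{PRE(g)},D\mid G=g)/\mathrm{var}(D\mid G=g)$; $\delta^{MID,PRE}(g,k):=(\mathbb{E}[\bar Y^{MID(g,k)}-\bar Y^{PRE(g)}\mid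 G=g]-\mathbb{E}[\bar Y^{MID(g,k)}-\bar Y^{PRE(g)}\mid G=k])/\mathbb{E}[D\mid G=g]$; $\delta^{POST,MID}(g,k):=(\mathbb{E}[\bar Y^{POST(k)}-\bar Y^{MID(g,k)}\mid G=k]-\mathbb{E}[\bar Y^{POST(k)}-\bar Y^{MID(g,k)}\mid G=g])/\mathbb{E}[D\mid G=k]$; $\delta^{POST,PRE}(g,k):=(\mathbb{E}[\bar Y^{POST(k)}-\bar Y^{PRE(g)}\mid G=g]-\mathbb{E}[\bar Y^{POST(k)}-\bar Y^{PRE(g)}\mid G=k])/(\mathbb{E}[D\mid G=g]-\mathbb{E}[D\mid G=k])$. Weights: $w_1^{within}(g,l):=\frac{(\mathbb{E}[D\mid G=g,D\ge l]-\mathbb{E}[D\mid G=g])\mathbb{P}(D\ge l\mid G=g)}{\mathrm{var}(D\mid G=g)}$; $w_1(g,l):=\frac{\mathbb{P}(D\ge l\mid G=g)}{\mathbb{E}[D\mid G=g]}$; $w_0(g):=\frac{d_L}{\mathbb{E}[D\mid G=g]}$; $w_1^{across}(g,k,l):=\frac{\mathbb{P}(D\ge l\mid G=g)-\mathbb{P}(D\ge l\mid G=k)}{\mathbb{E}[D\mid G=g]-\mathbb{E}[D\mid G=k]}$; $\tilde w_1^{across}(g,k,l):=\frac{\mathbb{P}(D\ge l\mid G=k)}{\mathbb{E}[D\mid G=g]-\mathbb{E}[D\mid G=k]}$; $\tilde w_0^{across}(g,k):=\frac{d_L}{\mathbb{E}[D\mid G=g]-\mathbb{E}[D\mid G=k]}$.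 *)

(* Defs.v *)
From HB Require Import structures.
From mathcomp Require Import all_boot all_order all_algebra.
From mathcomp Require Import all_classical all_reals all_analysis measurable_realfun.
Import Order.TTheory GRing.Theory Num.Theory.
Import numFieldNormedType.Exports.

Set Implicit Arguments.
Unset Strict Implicit.
Unset Printing Implicit Defensive.

Local Open Scope ring_scope.
Local Open Scope classical_set_scope.

Section Defs.
Context {dT : measure_display} {T : measurableType dT} {R : realType}.

Definition Ex (mu : {measure set T -> \bar R}) (X : T -> R) : R :=
  fine (\int[mu]_w (X w)%:E)%E.

Definition Pr (mu : {measure set T -> \bar R}) (A : set T) : R := fine (mu A).

Definition CE (mu : {measure set T -> \bar R}) (X : T -> R) (A : set T) : R :=
  Ex mu (fun w => X w * \1_A w) / Pr mu A.

Definition ccov (mu : {measure set T -> \bar R}) (X Z : T -> R) (A : set T) : R :=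
  CE mu (fun w => (X w - CE mu X A) * (Z w - CE mu Z A)) A.
Definition cvar (mu : {measure set T -> \bar R}) (X : T -> R) (A : set T) : R :=
  ccov mu X X A.

Definition evG (G : T -> nat) (g : nat) : set T := [set w | G w = g].
Definition evD0 (D : T -> R) : set T := [set w | D w = 0].
Definition evGge (G : T -> nat) (D : T -> R) (g : nat) (l : R) : set T :=
  [set w | G w = g /\ l <= D w].

(* k : R -> probability T R is a regular conditional distribution of the
   sample point given (G = g, D = d):  d |-> k d A is measurable and
   P(A /\ G = g /\ D in B) = E[ 1{G = g, D in B} k(D)(A) ]. *)
Definition is_cond_kernel (P : probability T R) (G : T -> nat) (D : T -> R)
  (g : nat) (k : R -> probability T R) : Prop :=
  (forall A, measurable A -> measurable_fun [set: R] (fun x => k x A)) /\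
  (forall A B, measurable A -> measurable B ->
     P (A `&` [set w | G w = g /\ B (D w)]) =
     (\int[P]_(w in [set w | G w = g /\ B (D w)]) k (D w) A)%E).

(* potential outcomes Y t g d;  Y_t(0) := Y_t(Tn+1, 0) *)
Definition Y0 (Y : nat -> nat -> R -> T -> R) (Tn t : nat) : T -> R :=
  Y t Tn.+1 0.

Definition Wt (G : T -> nat) (D : T -> R) (t : nat) (w : T) : R :=
  if (G w <= t)%N then D w else 0.

Definition Yobs (Y : nat -> nat -> R -> T -> R) (G : T -> nat) (D : T -> R)
  (Tn t : nat) (w : T) : R :=
  if (t < G w)%N then Y t Tn.+1 0 w else Y t (G w) (D w) w.

Definition PRE (g : nat) : nat * nat := (1%N, g.-1).
Definition MID (g k : nat) : nat * nat := (g, k.-1).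
Definition POST (Tn k : nat) : nat * nat := (k, Tn).

Definition wavg (Z : nat -> T -> R) (A : nat * nat) (w : T) : R :=
  (\sum_(A.1 <= t < A.2.+1) Z t w) / (A.2 - A.1).+1%:R.

Definition ATTbar (Y : nat -> nat -> R -> T -> R) (Tn : nat)
  (kern : nat -> R -> probability T R) (A : nat * nat) (g : nat) (a b : R) : R :=
  Ex (kern g b) (wavg (fun t w => Y t g a w - Y0 Y Tn t w) A).

Definition ACRTbar (Y : nat -> nat -> R -> T -> R) (Tn : nat)
  (kern : nat -> R -> probability T R) (A : nat * nat) (g : nat) (d : R) : R :=
  derive1 (fun a => ATTbar Y Tn kern A g a d) d.

Definition dATT_h (Y : nat -> nat -> R -> T -> R) (Tn : nat)
  (kern : nat -> R -> probability T R) (A : nat * nat) (g : nat) (l : R) : R :=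
  derive1 (fun h => ATTbar Y Tn kern A g l h) l.

Definition piD (P : probability T R) (D : T -> R) (Yo : nat -> T -> R)
  (kern : nat -> R -> probability T R) (A B : nat * nat) (g : nat) (d : R) : R :=
  Ex (kern g d) (fun w => wavg Yo A w - wavg Yo B w)
  - CE P (fun w => wavg Yo A w - wavg Yo B w) (evD0 D).

Definition piG (P : probability T R) (G : T -> nat) (D : T -> R)
  (Yo : nat -> T -> R) (A B : nat * nat) (g : nat) : R :=
  CE P (fun w => wavg Yo A w - wavg Yo B w) (evG G g)
  - CE P (fun w => wavg Yo A w - wavg Yo B w) (evD0 D).

Definition delta_WITHIN (P : probability T R) (G : T -> nat) (D : T -> R)
  (Yo : nat -> T -> R) (Tn g : nat) : R :=
  ccov P (fun w => wavg Yo (POST Tn g) w - wavg Yo (PRE g) w) D (evG G g)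
  / cvar P D (evG G g).

Definition delta_MID_PRE (P : probability T R) (G : T -> nat) (D : T -> R)
  (Yo : nat -> T -> R) (g k : nat) : R :=
  (CE P (fun w => wavg Yo (MID g k) w - wavg Yo (PRE g) w) (evG G g)
   - CE P (fun w => wavg Yo (MID g k) w - wavg Yo (PRE g) w) (evG G k))
  / CE P D (evG G g).

Definition delta_POST_MID (P : probability T R) (G : T -> nat) (D : T -> R)
  (Yo : nat -> T -> R) (Tn g k : nat) : R :=
  (CE P (fun w => wavg Yo (POST Tn k) w - wavg Yo (MID g k) w) (evG G k)
   - CE P (fun w => wavg Yo (POST Tn k) w - wavg Yo (MID g k) w) (evG G g))
  / CE P D (evG G k).

Definition delta_POST_PRE (P : probability T R) (G : T -> nat) (D : T -> R)
  (Yo : nat -> T -> R) (Tn g k : nat) : R :=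
  (CE P (fun w => wavg Yo (POST Tn k) w - wavg Yo (PRE g) w) (evG G g)
   - CE P (fun w => wavg Yo (POST Tn k) w - wavg Yo (PRE g) w) (evG G k))
  / (CE P D (evG G g) - CE P D (evG G k)).

Definition PDge (P : probability T R) (G : T -> nat) (D : T -> R)
  (g : nat) (l : R) : R :=
  Pr P (evGge G D g l) / Pr P (evG G g).

Definition w1_within (P : probability T R) (G : T -> nat) (D : T -> R)
  (g : nat) (l : R) : R :=
  (CE P D (evGge G D g l) - CE P D (evG G g)) * PDge P G D g l
  / cvar P D (evG G g).

Definition w1 (P : probability T R) (G : T -> nat) (D : T -> R)
  (g : nat) (l : R) : R :=
  PDge P G D g l / CE P D (evG G g).

Definition w0 (P : probability T R) (G : T -> nat) (D : T -> R)
  (dL : R) (g : nat) : R :=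
  dL / CE P D (evG G g).

Definition w1_across (P : probability T R) (G : T -> nat) (D : T -> R)
  (g k : nat) (l : R) : R :=
  (PDge P G D g l - PDge P G D k l) / (CE P D (evG G g) - CE P D (evG G k)).

Definition tw1_across (P : probability T R) (G : T -> nat) (D : T -> R)
  (g k : nat) (l : R) : R :=
  PDge P G D k l / (CE P D (evG G g) - CE P D (evG G k)).

Definition tw0_across (P : probability T R) (G : T -> nat) (D : T -> R)
  (dL : R) (g k : nat) : R :=
  dL / (CE P D (evG G g) - CE P D (evG G k)).

End Defs.

Section Reg.
Context {R : realType}.

(* f is continuously differentiable on the closed interval [a, b]:
   continuous on [a,b], differentiable on ]a,b[, and its derivative extends
   to a continuous function on [a,b] (equivalently: one-sided derivatives at
   the endpoints exist and f' is continuous on [a,b]). *)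
Definition C1_on (a b : R) (f : R -> R) : Prop :=
  {within `[a, b], continuous f} /\
  (forall x, a < x < b -> derivable f x 1) /\
  exists f' : R -> R, {within `[a, b], continuous f'} /\
    (forall x, a < x < b -> derive1 f x = f' x).

Definition diff_on_square (lo hi : R) (F : R -> R -> R) : Prop :=
  {within `[lo, hi] `*` `[lo, hi], continuous (fun p : R * R => F p.1 p.2)} /\
  (forall x y, lo < x < hi -> lo < y < hi ->
     differentiable (fun p : R * R => F p.1 p.2) (x, y)).

End Reg.

(* Main.v *)
(* Fix a timing group g and write m(x) for the mean, given G = g and D = x, of
   the observed change between a window A starting no earlier than g and a
   window B ending before g.

   A regular conditional law given (G = g, D = x) is concentrated on that event
   for almost every dose x.  There the observed outcomes are the potential
   outcomes, and parallel trends, telescoped over periods, give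
   m(x) = ATT^A(x | x) + c with c the same change among never-treated units.
   Since every dose belongs to the support and both sides are continuous, the
   identity holds for all x, and the chain rule along the diagonal identifies
   m' with the sum of the causal response and the selection derivative.

   As m(D) = m(d_L) + int_{d_L}^{D} m'(l) dl, Fubini's theorem yields
   E[psi(D) m(D) 1{G = g}] = m(d_L) E[psi(D) 1{G = g}]
     + int E[psi(D) 1{G = g, D >= l}] m'(l) dl.
   The within comparison is the case psi(D) = D - E[D | G = g]; the others use
   psi = 1 and differ only in which never-treated trends cancel. *)
Require Import Defs.
From HB Require Import structures.
From mathcomp Require Import all_boot all_order all_algebra.
From mathcomp Require Import all_classical all_reals all_analysis measurable_realfun.
From mathcomp Require Import ring lra.
Import Order.TTheory GRing.Theory Num.Theory.
Import numFieldNormedType.Exports.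
Local Open Scope ring_scope.
Local Open Scope classical_set_scope.

(** * Continuously differentiable functions on an interval *)

Lemma near_itv_oo {R : realType} {a b x : R} :
  a < x < b -> \forall y \near x, a < y < b.
Proof.
move=> xab; have : nbhs x `]a, b[%classic.
  by apply: open_nbhs_nbhs; split; [exact: interval_open | rewrite /= in_itv].
by apply: filterS => y /=; rewrite in_itv.
Qed.

Lemma eq_on_derivable {R : realType} {a b : R} {f h : R -> R} {x : R} :
  (forall y, a < y < b -> f y = h y) -> a < x < b ->
  derivable f x 1 -> derivable h x 1.
Proof.
move=> fh xab.
apply: near_eq_derivable.
by apply: filterS (near_itv_oo xab) => y; exact: fh.
Qed.

Lemma eq_on_derive1 {R : realType} {a b : R} {f h : R -> R} {x : R} :
  (forall y, a < y < b -> f y = h y) -> a < x < b ->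
  derive1 f x = derive1 h x.
Proof.
move=> fh xab; rewrite !derive1E.
apply: near_eq_derive.
by apply: filterS (near_itv_oo xab) => y; exact: fh.
Qed.

(** Agreement on the closed interval is enough: [C1_on] takes derivatives only at interior points,
    and around each of these the two functions coincide on a neighbourhood. *)
Lemma C1_on_ext {R : realType} {a b : R} {f h : R -> R} :
  (forall x, a <= x <= b -> f x = h x) -> C1_on a b f -> C1_on a b h.
Proof.
move=> fh [cf [df [f' [cf' ff']]]].
have fh' y : a < y < b -> f y = h y.
  by case/andP => ay yb; apply: fh; rewrite !ltW.
split; [|split].
- apply: (subspace_eq_continuous _ cf) => x.
  by move=> /set_mem /=; rewrite in_itv; exact: fh.
- by move=> x xab; apply: (eq_on_derivable fh' xab); exact: df.
- exists f'; split => // x xab.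
  by rewrite -(eq_on_derive1 fh' xab); exact: ff'.
Qed.

Lemma C1_on_cst {R : realType} (a b c : R) : C1_on a b (fun=> c).
Proof.
split; [|split].
- by apply: continuous_subspaceT => x; exact: cvg_cst.
- by move=> x _; exact: derivable_cst.
- exists (fun=> 0); split; first by apply: continuous_subspaceT => x; exact: cvg_cst.
  by move=> x _; rewrite derive1E derive_cst.
Qed.

Lemma C1_onD {R : realType} (a b : R) (f h : R -> R) :
  C1_on a b f -> C1_on a b h -> C1_on a b (fun x => f x + h x).
Proof.
move=> [cf [df [f' [cf' ff']]]] [ch [dh [h' [ch' hh']]]]; split; [|split].
- by move=> x; apply: cvgD; [exact: cf|exact: ch].
- by move=> x xab; apply: derivableD; [exact: df|exact: dh].
- exists (fun x => f' x + h' x); split.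
    by move=> x; apply: cvgD; [exact: cf'|exact: ch'].
  move=> x xab; rewrite -ff'// -hh'// !derive1E deriveD//; [exact: df|exact: dh].
Qed.

Lemma C1_onZ {R : realType} (a b c : R) (f : R -> R) :
  C1_on a b f -> C1_on a b (fun x => c * f x).
Proof.
move=> [cf [df [f' [cf' ff']]]]; split; [|split].
- by move=> x; apply: cvgM; [exact: cvg_cst|exact: cf].
- by move=> x xab; apply: derivableZ; exact: df.
- exists (fun x => c * f' x); split.
    by move=> x; apply: cvgM; [exact: cvg_cst|exact: cf'].
  by move=> x xab; rewrite -ff'// !derive1E deriveZ//; exact: df.
Qed.

Lemma C1_on_sum {R : realType} (a b : R) (s : seq nat) (f : nat -> R -> R) :
  (forall i, i \in s -> C1_on a b (f i)) ->
  C1_on a b (fun x => \sum_(i <- s) f i x).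
Proof.
elim: s => [|i s IH] hs.
  by apply: (C1_on_ext _ (C1_on_cst a b 0)) => x _; rewrite big_nil.
have {}IH : C1_on a b (fun x => \sum_(i <- s) f i x).
  by apply: IH => j js; apply: hs; rewrite in_cons js orbT.
have := C1_onD _ _ _ _ (hs i (mem_head _ _)) IH.
by apply: C1_on_ext => x _; rewrite big_cons.
Qed.

(** The derivative enters as a separate function [f'], because [derive1 f] is not controlled at the
    endpoints. *)
Lemma C1_on_FTC {R : realType} (a b : R) (f f' : R -> R) :
  {within `[a, b], continuous f} ->
  (forall x, a < x < b -> derivable f x 1) ->
  {within `[a, b], continuous f'} ->
  (forall x, a < x < b -> derive1 f x = f' x) ->
  forall x, a <= x <= b ->
  f x = f a + \int[lebesgue_measure]_(l in `[a, x]) f' l.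
Proof.
move=> cf df cf' ff' x /andP[]; rewrite le_eqVlt => /predU1P[<- _|ax xb].
  by rewrite set_itv1 Rintegral_set1 addr0.
have sub : `[a, x] `<=` `[a, b] by apply: subset_itvl; rewrite bnd_simp.
have sw (h : R -> R) : {within `[a, b], continuous h} -> {within `[a, x], continuous h}.
  by apply: continuous_subspaceW.
have ltb y : y \in `]a, x[%R -> a < y < b.
  by rewrite in_itv /= => /andP[-> yx]; exact: lt_le_trans xb.
rewrite /Rintegral (@continuous_FTC2 _ f' f)//=.
- by rewrite subrKC.
- exact: sw.
- have [] := (continuous_within_itvP f ax).1 (sw _ cf).
  by move=> _ fa fx; split => // y /ltb; exact: df.
- by move=> y /ltb; exact: ff'.
Qed.

(** All three derivatives are values of the single differential of [F] at [(l, l)], in the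
    directions (1,1), (1,0) and (0,1); linearity adds the last two. *)
Lemma derive1_diag {R : realType} (F : R -> R -> R) (l : R) :
  differentiable (fun p : R * R => F p.1 p.2) (l, l) ->
  derive1 (fun x => F x x) l =
  derive1 (fun x => F x l) l + derive1 (fun x => F l x) l.
Proof.
move=> dF; set H := fun p : R * R => F p.1 p.2 in dF.
(* One chain rule for curves through [(l, l)], used for the diagonal and for both axis-parallel
   lines. *)
have along (u v : R -> R) (du dv : R -> R) : is_diff l u du -> is_diff l v dv ->
    u l = l -> v l = l ->
    derive1 (fun x => F (u x) (v x)) l = 'd H (l, l) (du 1, dv 1).
  move=> hu hv ul vl; have huv := is_diff_pair hu hv.
  have dc : differentiable (fun x => (u x, v x)) l by [].
  have dH : differentiable H (u l, v l) by rewrite ul vl.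
  rewrite (_ : (fun x => F (u x) (v x)) = H \o (fun x => (u x, v x)))//.
  rewrite derive1E'; last exact: (@differentiable_comp _ _ _ _ (fun x => (u x, v x)) H).
  by rewrite diff_comp//= diff_val ul vl.
rewrite (along id id id id)// (along id (cst l) id 0)// (along (cst l) id 0 id)//.
rewrite -[RHS](linearD ('d H (l, l))) /=; congr ('d H _ _).
by congr pair; rewrite /= ?addr0 ?add0r.
Qed.

Lemma within_diag_continuous {R : realType} (a b : R) (F : R -> R -> R) :
  {within `[a, b] `*` `[a, b], continuous (fun p : R * R => F p.1 p.2)} ->
  {within `[a, b], continuous (fun x => F x x)}.
Proof.
move=> cF; apply/subspace_continuousP => x xab.
have := (subspace_continuousP _ _).1 cF (x, x) (conj xab xab) => /= h.
apply: (@cvg_comp _ _ _ (fun y : R => (y, y)) (fun p : R * R => F p.1 p.2) _ _ _ _ h).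
move=> A; rewrite /within /= => -[[U V] /= [nU nV] UV].
have : nbhs x (U `&` V) by exact: filterI.
change (nbhs x (U `&` V) -> \forall y \near x, `[a, b]%classic y -> A (y, y)).
apply: filterS => y [Uy Vy] yab.
by apply: (UV (y, y)) => //; split.
Qed.

Lemma within_continuous_dense_eq {R : realType} (a b : R) (f h : R -> R)
    (S : set R) :
  {within `[a, b], continuous f} -> {within `[a, b], continuous h} ->
  (forall x, S x -> f x = h x) ->
  (forall x e, a <= x <= b -> 0 < e ->
     exists2 y, S y & (a <= y <= b) /\ `|y - x| < e) ->
  forall x, a <= x <= b -> f x = h x.
Proof.
move=> cf ch fh dS x xab; apply/eqP; rewrite -subr_eq0 -normr_eq0; apply/negPn/negP => n0.
(* [e] is the supposed gap at [x]. A nearby point of [S] where each function is within [e / 2] of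
   its value at [x] would give [e < e]. *)
set e := `|f x - h x| in n0 *.
have e0 : 0 < e by rewrite lt_neqAle eq_sym n0 normr_ge0.
have e2 : 0 < e / 2 by rewrite divr_gt0.
have /cvgrPdist_lt /(_ _ e2) nf := (subspace_continuousP _ _).1 cf x xab.
have /cvgrPdist_lt /(_ _ e2) nh := (subspace_continuousP _ _).1 ch x xab.
have [d /= d0 hd] : \forall y \near x, `[a, b]%classic y ->
    `|f x - f y| < e / 2 /\ `|h x - h y| < e / 2.
  by move: nf nh; rewrite !near_withinE => nf nh; near=> y => yab; split;
    [exact: (near nf)|exact: (near nh)].
have [y Sy [yab yx]] := dS x d xab d0.
have [fy hy] : `|f x - f y| < e / 2 /\ `|h x - h y| < e / 2.
  by apply: hd => //=; rewrite distrC.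
have : e < e; last by rewrite ltxx.
rewrite {1}/e.
have -> : f x - h x = (f x - f y) - (h x - h y) by rewrite (fh y Sy); ring.
apply: (le_lt_trans (ler_normB _ _)); rewrite [ltRHS](splitr e); exact: ltrD.
Unshelve. all: by end_near. Qed.

(** * Disintegration along a conditional kernel *)

(** [P], viewed as a kernel from the one-point space [unit], composed with [K] yields [Q]; the claim
    is then the integration formula for composed kernels. *)
Lemma ge0_integral_mixture {dT dU : measure_display} {T : measurableType dT}
    {U : measurableType dU} {R : realType}
    (P : probability T R) (Q : probability U R) (K : T -> probability U R)
    (f : U -> \bar R) :
  (forall A, measurable A -> measurable_fun [set: T] (fun w => K w A)) ->
  (forall A, measurable A -> Q A = (\int[P]_w K w A)%E) ->
  (forall u, 0 <= f u)%E -> measurable_fun [set: U] f ->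
  (\int[Q]_u f u = \int[P]_w \int[K w]_u f u)%E.
Proof.
move=> mK PQ f0 mf.
pose l0 : unit -> {measure set T -> \bar R} := fun=> P.
have ml0 A : measurable A -> measurable_fun [set: unit] (l0 ^~ A).
  by move=> mA; exact: measurable_cst.
have l01 x : (l0 x [set: T] = 1)%E by exact: probability_setT.
pose lK := isKernel.Build _ _ _ _ _ l0 ml0.
pose l1 : R.-ker unit ~> T := HB.pack l0 lK.
pose l : R.-pker unit ~> T := HB.pack l0 lK (Kernel_isProbability.Build _ _ _ _ _ l1 l01).
pose k0 : unit * T -> {measure set U -> \bar R} := fun x => K x.2.
have mk0 A : measurable A -> measurable_fun [set: unit * T] (k0 ^~ A).
  by move=> mA; exact: (measurableT_comp (mK A mA) measurable_snd).
have k01 x : (k0 x [set: U] = 1)%E by exact: probability_setT.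
pose kK := isKernel.Build _ _ _ _ _ k0 mk0.
pose k1 : R.-ker _ ~> U := HB.pack k0 kK.
pose k : R.-pker (unit * T) ~> U := HB.pack k0 kK (Kernel_isProbability.Build _ _ _ _ _ k1 k01).
have -> : (\int[Q]_u f u = \int[mkcomp l k tt]_u f u)%E.
  by apply: eq_measure_integral => A mA _; exact: PQ.
exact: integral_kcomp.
Qed.

(** Positive and negative parts are handled separately: each has an integrable kernel average
    because its iterated integral equals a finite one. *)
Lemma integral_mixture {dT dU : measure_display} {T : measurableType dT}
    {U : measurableType dU} {R : realType}
    (P : probability T R) (Q : probability U R) (K : T -> probability U R)
    (f : U -> \bar R) :
  (forall A, measurable A -> measurable_fun [set: T] (fun w => K w A)) ->
  (forall A, measurable A -> Q A = (\int[P]_w K w A)%E) ->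
  Q.-integrable [set: U] f ->
  P.-integrable [set: T] (fun w => \int[K w]_u f u)%E /\
  (\int[Q]_u f u = \int[P]_w \int[K w]_u f u)%E.
Proof.
move=> mK PQ intf.
have mf := measurable_int _ intf.
have mix h : (forall u, 0 <= h u)%E -> Q.-integrable [set: U] h ->
    P.-integrable [set: T] (fun w => \int[K w]_u h u)%E /\
    (\int[Q]_u h u = \int[P]_w \int[K w]_u h u)%E.
  move=> h0 ih; have mh := measurable_int _ ih.
  have e := ge0_integral_mixture P Q K h mK PQ h0 mh.
  split=> //; apply/integrableP; split.
    exact: measurable_fun_integral_kernel.
  under eq_integral do rewrite gee0_abs ?integral_ge0//.
  rewrite -e; case/integrableP : ih => _.
  by under eq_integral do rewrite gee0_abs//.
have [ip ep] := mix _ (funepos_ge0 f) (integrable_funepos measurableT intf).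
have [im em] := mix _ (funeneg_ge0 f) (integrable_funeneg measurableT intf).
have fE : (fun w => \int[K w]_u f u)%E =
    (fun w => \int[K w]_u f^\+%E u - \int[K w]_u f^\-%E u)%E.
  by apply/funext => w; rewrite integralE.
split; first by rewrite fE; exact: integrableB.
by rewrite fE integralB// -ep -em integralE.
Qed.

Lemma measurable_level_set {dT : measure_display} {T : measurableType dT}
    {R : realType} (G : T -> nat) (D : T -> R) (g : nat) (B : set R) :
  measurable (evG G g) -> measurable_fun [set: T] D -> measurable B ->
  measurable [set w | G w = g /\ B (D w)].
Proof.
move=> mG mD mB.
rewrite (_ : [set w | _] = evG G g `&` (D @^-1` B))//.
by apply: measurableI => //; rewrite -[X in measurable X]setTI; exact: mD.
Qed.

(** The defining identity of the kernel has left side P of the empty set, and a nonnegative function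
    with zero integral vanishes almost everywhere. *)
Lemma cond_kernel_null {dT : measure_display} {T : measurableType dT}
    {R : realType} (P : probability T R) (G : T -> nat) (D : T -> R) (g : nat)
    (k : R -> probability T R) (A : set T) (B : set R) :
  measurable (evG G g) -> measurable_fun [set: T] D -> is_cond_kernel P G D g k ->
  measurable A -> measurable B -> A `&` [set w | G w = g /\ B (D w)] = set0 ->
  {ae P, forall w, G w = g -> B (D w) -> k (D w) A = 0%E}.
Proof.
move=> mG mD [mk hk] mA mB AB0.
have mE := measurable_level_set G D g B mG mD mB.
have := hk _ _ mA mB; rewrite AB0 measure0 => /esym.
under eq_integral => w _ do rewrite -[k _ _]gee0_abs ?measure_ge0//.
move/ae_eq_integral_abs => /(_ mE).
have mkD : measurable_fun [set w | G w = g /\ B (D w)] (fun w => k (D w) A).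
  by apply: measurable_funTS; exact: (measurableT_comp (mk _ mA) mD).
by move=> /(_ mkD); apply: filterS => w h Gw Bw; apply: h.
Qed.

(* Only countably many null sets are discarded: those attached to the open
   intervals with rational endpoints. *)
Lemma cond_kernel_concentrated {dT : measure_display} {T : measurableType dT}
    {R : realType} (P : probability T R) (G : T -> nat) (D : T -> R) (g : nat)
    (k : R -> probability T R) :
  measurable (evG G g) -> measurable_fun [set: T] D -> is_cond_kernel P G D g k ->
  {ae P, forall w, G w = g ->
     (k (D w)).-negligible (~` [set v | G v = g /\ D v = D w])}.
Proof.
move=> mG mD hk.
pose I (n : nat) : set R :=
  if unpickle n is Some pq then `]ratr (pq : rat * rat).1, ratr pq.2[%classic else set0.
have mI n : measurable (I n) by rewrite /I; case: unpickle.
pose A n := ~` [set v | G v = g /\ I n (D v)].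
have mA n : measurable (A n) by apply: measurableC; exact: measurable_level_set.
have h n : {ae P, forall w, G w = g -> I n (D w) -> k (D w) (A n) = 0%E}.
  by apply: cond_kernel_null => //; rewrite /A setICl.
apply: filterS (ae_foralln h) => w {}h Gw.
pose N := \bigcup_n [set v | I n (D w) /\ A n v].
have nN : (k (D w)).-negligible N.
  apply: negligible_bigcup => n; have [Iw|nI] := pselect (I n (D w)).
    by exists (A n); split => //; [exact: h|move=> v []].
  by exists set0; split => // v [].
suff sN : ~` [set v | G v = g /\ D v = D w] `<=` N by exact: negligibleS sN nN.
move=> v /= nv.
  (* If [D v = D w], then [v] fails [G v = g] and any radius works; otherwise the distance of the
     two doses is a radius that excludes [D v]. Rational endpoints inside this radius then give the
     interval that catches [v]. *)
  have [e e0 he] : exists2 e, 0 < e & `|D v - D w| < e -> ~ (G v = g).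
    have [DD|DD] := eqVneq (D v) (D w).
      by exists 1 => // _ Gv; apply: nv.
    by exists `|D v - D w|; [rewrite normr_gt0 subr_eq0|rewrite ltxx].
  have Dm : D w - e < D w by rewrite ltrBlDr ltrDl.
  have Dp : D w < D w + e by rewrite ltrDl.
  have [p] := rat_in_itvoo Dm.
  rewrite in_itv /= => /andP[p1 p2].
  have [q] := rat_in_itvoo Dp.
  rewrite in_itv /= => /andP[q1 q2].
  have [n Iw] : exists n, forall x, I n x <-> ratr p < x < ratr q.
    exists (pickle (p, q)) => x; rewrite /I pickleK.
    by rewrite /= in_itv.
  exists n; first by [].
  split; first by apply/Iw; rewrite p2 q1.
  move=> [Gv /Iw /andP[pv vq]]; apply: he Gv; rewrite ltr_distl; apply/andP; split.
    exact: lt_trans p1 pv.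
  exact: lt_trans vq q2.
Qed.

(* Completing the conditional kernel by Dirac masses off the event turns it
   into a disintegration of the whole probability. *)
Lemma cond_kernel_integral {dT : measure_display} {T : measurableType dT}
    {R : realType} (P : probability T R) (G : T -> nat) (D : T -> R) (g : nat)
    (k : R -> probability T R) (f h : T -> \bar R) :
  measurable (evG G g) -> measurable_fun [set: T] D -> is_cond_kernel P G D g k ->
  P.-integrable [set: T] f -> (forall w, ~ evG G g w -> f w = 0%E) ->
  measurable_fun [set: T] h -> (forall w, ~ evG G g w -> h w = 0%E) ->
  {ae P, forall w, G w = g -> (\int[k (D w)]_v f v = h w)%E} ->
  (\int[P]_w f w = \int[P]_w h w)%E.
Proof.
move=> mG mD [mk hk] fi f0 mh h0 fh.
have mf := measurable_int _ fi.
pose K (w : T) : probability T R :=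
  if w \in evG G g then k (D w) else (\d_w : probability T R).
have KE A w : K w A = if w \in evG G g then k (D w) A else (\d_w A)%E.
  by rewrite /K; case: ifP.
have mK A : measurable A -> measurable_fun [set: T] (fun w => K w A).
  move=> mA; under eq_fun do rewrite KE.
  apply: measurable_fun_ifT.
  - apply: (@measurable_fun_bool _ _ _ _ true); rewrite setTI.
    rewrite (_ : _ @^-1` _ = evG G g)//.
    by apply/seteqP; split => w /=; [exact: set_mem|exact: mem_set].
  - exact: (measurableT_comp (mk _ mA) mD).
  - exact: measurable_fun_dirac.
(* [K] leaves [P] invariant: on the event this is the defining property with [B] the whole line, off
   it the Dirac masses return the indicator of [A]. *)
have PK A : measurable A -> P A = (\int[P]_w K w A)%E.
  move=> mA.
  have setGT : [set w | G w = g /\ [set: R] (D w)] = evG G g.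
    by apply/seteqP; split => [w []|w].
  have kA := hk _ _ mA measurableT; rewrite setGT in kA.
  rewrite -(setUv (evG G g)) ge0_integral_setU//; last 3 first.
  - exact: measurableC.
  - by rewrite setUv; exact: mK.
  - by apply/disj_setPS; rewrite setICr.
  rewrite [X in (X + _)%E](_ : _ = P (A `&` evG G g)); last first.
    by rewrite kA; apply: eq_integral => w wE; rewrite KE wE.
  rewrite [X in (_ + X)%E](_ : _ = P (A `&` ~` evG G g)); last first.
    rewrite -integral_indic//; last exact: measurableC.
    apply: eq_integral => w; rewrite inE /= => nE.
    by rewrite KE memNset// /dirac.
  rewrite -measureU//.
  - by rewrite -setIUr setUv setIT.
  - exact: measurableI.
  - by apply: measurableI => //; exact: measurableC.
  - by rewrite setIACA setICr setI0.
have [ai ->] := integral_mixture P P K f mK PK fi.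
apply: ae_eq_integral => //; first exact: measurable_int ai.
apply: filterS fh => w fh _ /=.
have [wE|wE] := boolP (w \in evG G g).
  have -> : K w = k (D w) by rewrite /K wE.
  by apply: fh; move/set_mem : wE.
have nE : ~ evG G g w by move=> /mem_set; exact/negP.
have -> : K w = (\d_w : probability T R) by rewrite /K (negbTE wE).
by rewrite integral_dirac// diracT mul1e f0// h0.
Qed.

(** * Layer-cake formula *)

Lemma integrable_mul_bounded {d : measure_display} {T : measurableType d}
    {R : realType} (mu : {measure set T -> \bar R}) (X phi : T -> R) (M : R) :
  mu.-integrable [set: T] (EFin \o X) -> measurable_fun [set: T] phi ->
  (forall w, `|phi w| <= M) ->
  mu.-integrable [set: T] (fun w => (X w * phi w)%:E).
Proof.
move=> iX mphi bphi.
have mX := (measurable_EFinP _ _).1 (measurable_int _ iX).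
apply: (le_integrable measurableT (g := fun w => (M%:E * (X w)%:E)%E)).
- by apply/measurable_EFinP; apply: measurable_funM => //; exact/measurable_EFinP.
- move=> w _ /=; rewrite lee_fin !normrM mulrC ler_wpM2r//.
  exact: le_trans (bphi w) (ler_norm _).
- exact: integrableZl.
Qed.

Lemma integrable_bounded_prob {d : measure_display} {T : measurableType d}
    {R : realType} (P : probability T R) (phi : T -> R) (M : R) :
  measurable_fun [set: T] phi -> (forall w, `|phi w| <= M) ->
  P.-integrable [set: T] (EFin \o phi).
Proof.
move=> mphi bphi.
have := integrable_mul_bounded P (fun=> 1) phi M _ mphi bphi.
rewrite (_ : (fun w => (1 * phi w)%:E) = EFin \o phi); last first.
  by apply/funext => w /=; rewrite mul1r.
by apply; apply: finite_measure_integrable_cst.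
Qed.

Lemma ExE {d : measure_display} {T : measurableType d} {R : realType}
    (mu : {measure set T -> \bar R}) (X : T -> R) :
  mu.-integrable [set: T] (EFin \o X) ->
  (\int[mu]_w (X w)%:E)%E = (Ex mu X)%:E.
Proof. by move=> iX; rewrite /Ex fineK//; exact: integrable_fin_num. Qed.

(** Extension by zero makes a function that is regular only on the dose interval measurable and
    integrable on the whole line, as Fubini on the full product requires. *)
Definition cutoff {R : realType} (a b : R) (m : R -> R) (x : R) : R :=
  if x \in `[a, b]%R then m x else 0.

Lemma measurable_cutoff {R : realType} (a b : R) (m : R -> R) :
  {within `[a, b], continuous m} -> measurable_fun [set: R] (cutoff a b m).
Proof.
move=> cm; apply: measurable_fun_if => //.
- apply: (@measurable_fun_bool _ _ _ _ true); rewrite setTI.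
  by rewrite (_ : _ @^-1` _ = `[a, b]%classic)//; exact: measurable_itv.
- rewrite setTI (_ : _ @^-1` _ = `[a, b]%classic)//.
  by apply: subspace_continuous_measurable_fun.
Qed.

Lemma integrable_cutoff {R : realType} (a b : R) (m : R -> R) :
  {within `[a, b], continuous m} ->
  lebesgue_measure.-integrable [set: R] (EFin \o cutoff a b m).
Proof.
move=> cm.
have -> : EFin \o cutoff a b m = (EFin \o m) \_ `[a, b]%classic.
  by apply/funext => l; rewrite patchE mem_setE /cutoff /=; case: ifP.
apply/(integrable_mkcond _ _).1 => //.
by apply: continuous_compact_integrable => //; exact: segment_compact.
Qed.

(** Moves the variable upper limit [x] into the integrand, so that the domain is fixed when [x]
    becomes a random dose. *)
Lemma integral_cutoff {R : realType} (a b x : R) (m : R -> R) : x <= b ->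
  (\int[lebesgue_measure]_(l in `[a, x]) (m l)%:E =
   \int[lebesgue_measure]_l (if (l <= x)%R then cutoff a b m l else 0)%:E)%E.
Proof.
move=> xb; rewrite integral_mkcond; apply: eq_integral => l _.
rewrite patchE /cutoff mem_setE !in_itv /=.
case: (leP a l) => //= al; last by case: ifP.
case: (leP l x) => //= lx.
by rewrite (le_trans lx xb).
Qed.

(** Off [E] the indicator kills the product, and on [E] the dose lies in the interval, so [m] can be
    replaced by its extension by zero. *)
Lemma measurable_comp_on {dT : measure_display} {T : measurableType dT}
    {R : realType} (D : T -> R) (E : set T) (a b : R) (m : R -> R) :
  measurable_fun [set: T] D -> measurable E ->
  (forall w, E w -> a <= D w <= b) -> {within `[a, b], continuous m} ->
  measurable_fun [set: T] (fun w => m (D w) * \1_E w).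
Proof.
move=> mD mE Eab cm.
rewrite (_ : (fun w => _) = (fun w => cutoff a b m (D w) * \1_E w)); last first.
  apply/funext => w; rewrite indicE; case: (boolP (w \in E)) => [/set_mem wE|_].
    by rewrite /cutoff in_itv /= Eab.
  by rewrite !mulr0.
apply: measurable_funM; last exact: measurable_indic.
exact: (measurableT_comp (measurable_cutoff a b m cm) mD).
Qed.

(** The integrand whose order of integration is exchanged: integrating out the level gives the
    increment of [m] from [a] to the dose times [phi], integrating out the sample point gives a
    survival expectation times [m']. *)
Definition layer_fun {T : Type} {R : realType} (D phi : T -> R) (a b : R)
    (m' : R -> R) (p : T * R) : R :=
  phi p.1 * \1_[set q : T * R | q.2 <= D q.1] p * cutoff a b m' p.2.

(** The integrand is dominated by [M] times the absolute value of the cut-off [m'], which depends on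
    the level alone and is integrable; the other factor has total mass one. *)
Lemma integrable_layer_fun {dT : measure_display} {T : measurableType dT}
    {R : realType} (P : probability T R) (D phi : T -> R) (M a b : R)
    (m' : R -> R) :
  measurable_fun [set: T] D -> measurable_fun [set: T] phi ->
  (forall w, `|phi w| <= M) -> {within `[a, b], continuous m'} ->
  (P \x @lebesgue_measure R)%E.-integrable [set: T * R]
    (EFin \o layer_fun D phi a b m').
Proof.
move=> mD mphi bphi cm'.
pose mu := @lebesgue_measure R.
pose n := cutoff a b m'.
have inn : mu.-integrable [set: R] (EFin \o n) by exact: integrable_cutoff.
have mn : measurable_fun [set: R] n by exact: measurable_cutoff.
pose S : set (T * R) := [set p | p.2 <= D p.1].
have mS : measurable S.
  rewrite -[S]setTI; apply: measurable_fun_le => //.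
  exact: (measurableT_comp mD measurable_fst).
pose F := layer_fun D phi a b m'.
have mF : measurable_fun [set: T * R] F.
  apply: measurable_funM; last exact: (measurableT_comp mn measurable_snd).
  apply: measurable_funM; first exact: (measurableT_comp mphi measurable_fst).
  exact: measurable_indic.
have i1 (B : bool) : `|B%:R| <= 1 :> R by case: B; rewrite ?normr1 ?normr0.
have Fle w l : `|F (w, l)| <= M * `|n l|.
  rewrite /F /layer_fun /= !normrM ler_wpM2r// -[leRHS]mulr1.
  by apply: ler_pM => //; rewrite indicE; exact: i1.
(* The sample space is pointed, so the bound on [phi] is attested at some point. *)
have M0 : 0 <= M by apply: le_trans (bphi point); exact: normr_ge0.
apply/integrable12ltyP; first exact/measurable_EFinP.
apply: (@le_lt_trans _ _ (\int[P]_w (M%:E * \int[mu]_l `|(n l)%:E|))%E).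
  apply: ge0_le_integral => //=.
  - by move=> w _; exact: integral_ge0.
  - apply: (@measurable_fun_fubini_tonelli_F _ _ _ _ _ mu (fun p => `|(F p)%:E|%E)) => //.
    by apply: measurableT_comp => //; exact/measurable_EFinP.
  - move=> w _.
    have mn' : measurable_fun [set: R] (fun l => `|(n l)%:E|%E).
      by apply: measurableT_comp => //; exact/measurable_EFinP.
    have mFw : measurable_fun [set: R] (fun l => `|(F (w, l))%:E|%E).
      apply: measurableT_comp => //; apply/measurable_EFinP.
      exact: (measurableT_comp mF (pair1_measurable w)).
    rewrite -ge0_integralZl_EFin//.
    apply: ge0_le_integral => //.
      exact: measurable_funeM mn'.
    by move=> l _; rewrite -EFinM lee_fin; exact: Fle.
rewrite integral_cst//= probability_setT mule1.
have /integrableP[_ nlt] := inn.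
by rewrite lte_mul_pinfty.
Qed.

Lemma integral_layer_fun {dT : measure_display} {T : measurableType dT}
    {R : realType} (P : probability T R) (D phi : T -> R) (M a b : R)
    (m' : R -> R) (l : R) :
  measurable_fun [set: T] D -> measurable_fun [set: T] phi ->
  (forall w, `|phi w| <= M) ->
  (\int[P]_w (layer_fun D phi a b m' (w, l))%:E =
   (Ex P (fun w => phi w * \1_[set v | l <= D v] w) * cutoff a b m' l)%:E)%E.
Proof.
move=> mD mphi bphi.
have mSl : measurable [set v | l <= D v].
  rewrite -[X in measurable X]setTI; exact: measurable_fun_le.
have i1 (B : bool) : `|B%:R| <= 1 :> R by case: B; rewrite ?normr1 ?normr0.
have il : P.-integrable [set: T] (EFin \o (fun w => phi w * \1_[set v | (l <= D v)%R] w)).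
  apply: (integrable_bounded_prob P _ M).
    by apply: measurable_funM => //; exact: measurable_indic.
  move=> w; rewrite normrM -[leRHS]mulr1.
  by apply: ler_pM => //; rewrite indicE; exact: i1.
by rewrite EFinM -ExE// -integralZr//; apply: eq_integral.
Qed.

(** This is a marginal of the integrable [layer_fun]. Later steps rely on it to pull constants out
    of the level integrals and to split their differences. *)
Lemma integrable_survival {dT : measure_display} {T : measurableType dT}
    {R : realType} (P : probability T R) (D phi : T -> R) (M a b : R)
    (m' : R -> R) :
  measurable_fun [set: T] D -> measurable_fun [set: T] phi ->
  (forall w, `|phi w| <= M) -> {within `[a, b], continuous m'} ->
  lebesgue_measure.-integrable `[a, b] (EFin \o (fun l =>
    Ex P (fun w => phi w * \1_[set v | l <= D v] w) * m' l)).
Proof.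
move=> mD mphi bphi cm'; apply/(integrable_mkcond _ _).2 => //.
have iF := integrable_layer_fun P D phi M a b m' mD mphi bphi cm'.
have mF := measurable_int _ iF.
have mG := measurable_fubini_G iF.
have : lebesgue_measure.-integrable [set: R]
    (fubini_G P (EFin \o layer_fun D phi a b m')).
  apply/integrableP; split => //.
  have h := (integrable21ltyP _ _ mF).1 iF; apply: (le_lt_trans _ h).
  apply: ge0_le_integral => //.
  - exact: measurableT_comp.
  - apply: (@measurable_fun_fubini_tonelli_G _ _ _ _ _ P
      (fun p => `|(EFin \o layer_fun D phi a b m') p|%E)) => //.
    exact: measurableT_comp.
  - move=> l _; apply: le_abse_integral => //.
    exact: (measurableT_comp mF (pair2_measurable l)).
rewrite (_ : fubini_G _ _ = (EFin \o (fun l =>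
    Ex P (fun w => phi w * \1_[set v | l <= D v] w) * m' l)) \_ `[a, b]%classic)//.
apply/funext => l; rewrite /fubini_G /= (integral_layer_fun P D phi M)//.
by rewrite patchE mem_setE /cutoff /=; case: ifP => //; rewrite mulr0.
Qed.

Lemma layer_cake {dT : measure_display} {T : measurableType dT} {R : realType}
    (P : probability T R) (D phi : T -> R) (M a b : R) (m m' : R -> R) :
  measurable_fun [set: T] D -> measurable_fun [set: T] phi ->
  (forall w, `|phi w| <= M) ->
  (forall w, phi w != 0 -> a <= D w <= b) ->
  {within `[a, b], continuous m'} ->
  (forall x, a <= x <= b ->
     m x = m a + \int[lebesgue_measure]_(l in `[a, x]) m' l) ->
  Ex P (fun w => m (D w) * phi w) =
  m a * Ex P phi +
  \int[lebesgue_measure]_(l in `[a, b])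
    (Ex P (fun w => phi w * \1_[set v | l <= D v] w) * m' l).
Proof.
move=> mD mphi bphi Dab cm' FTC.
pose mu := @lebesgue_measure R.
pose n := cutoff a b m'.
have inn : mu.-integrable [set: R] (EFin \o n) by exact: integrable_cutoff.
pose F := layer_fun D phi a b m'.
have iF := integrable_layer_fun P D phi M a b m' mD mphi bphi cm'.
have mn : measurable_fun [set: R] n by exact: measurable_cutoff.
(* Integrating out the level recovers the increment of [m] by the fundamental theorem of calculus.
   Where [phi] vanishes both sides are zero, so the dose may lie outside the interval there. *)
have FE w : (\int[mu]_l (F (w, l))%:E = ((m (D w) - m a) * phi w)%:E)%E.
  have [p0|p0] := eqVneq (phi w) 0.
    rewrite p0 mulr0 (eq_integral (cst 0%E)) ?integral0// => l _.
    by rewrite /F /layer_fun /= p0 !mul0r.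
  have Dw := Dab w p0; have /andP[_ Db] := Dw.
  have sD : `[a, D w]%classic `<=` `[a, b]%classic.
    by apply: subset_itvl; rewrite bnd_simp.
  have im' : mu.-integrable `[a, D w] (EFin \o m').
    have im : mu.-integrable `[a, b] (EFin \o m').
      by apply: continuous_compact_integrable => //; exact: segment_compact.
    by apply: integrableS im => //; exact: sD.
  rewrite (FTC _ Dw) addrC addKr mulrC EFinM /Rintegral fineK; last first.
    exact: integrable_fin_num.
  rewrite (integral_cutoff a b)// -integralZl//; last first.
    apply: le_integrable inn => //.
      apply/measurable_EFinP; apply: measurable_fun_ifT => //.
      by apply: measurable_fun_ler.
    by move=> l _ /=; rewrite lee_fin; case: ifP => // _; rewrite normr0.
  apply: eq_integral => l _; rewrite -EFinM /F /layer_fun /= indicE.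
  case: (boolP (l <= D w)) => lD; first by rewrite mem_set// mulr1.
  by rewrite memNset ?mulr0 ?mul0r//; exact/negP.
have iP : P.-integrable [set: T] (EFin \o (fun w => (m (D w) - m a) * phi w)).
  rewrite (_ : EFin \o _ = fubini_F mu (EFin \o F)); first exact: integrable_fubini_F.
  by apply/funext => w; rewrite /fubini_F /= FE.
have iphi : P.-integrable [set: T] (EFin \o phi).
  exact: (integrable_bounded_prob P _ M).
have E1 : Ex P (fun w => (m (D w) - m a) * phi w) =
    \int[lebesgue_measure]_(l in `[a, b])
    (Ex P (fun w => phi w * \1_[set v | l <= D v] w) * m' l).
  rewrite /Ex /Rintegral; congr fine.
  transitivity (\int[P]_w \int[mu]_l (EFin \o F) (w, l))%E.
    by apply: eq_integral => w _; rewrite FE.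
  rewrite (Fubini iF) integral_mkcond; apply: eq_integral => l _.
  rewrite /= (integral_layer_fun P D phi M)// patchE mem_setE /cutoff; case: ifP => //.
  by rewrite mulr0.
rewrite -E1 addrC.
transitivity (Ex P (fun w => (m (D w) - m a) * phi w + m a * phi w)).
  by congr (Ex P _); apply/funext => w; rewrite -mulrDl subrK.
rewrite /Ex -/(Rintegral P setT _) RintegralD//; last first.
  rewrite (_ : EFin \o _ = (fun w => (m a)%:E * (EFin \o phi) w)%E)//.
  exact: integrableZl.
by rewrite RintegralZl.
Qed.

(** * Group expectations through the conditional kernel *)

Lemma ExB {d : measure_display} {T : measurableType d} {R : realType}
    (mu : {measure set T -> \bar R}) (X Z : T -> R) :
  mu.-integrable [set: T] (EFin \o X) -> mu.-integrable [set: T] (EFin \o Z) ->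
  Ex mu (fun w => X w - Z w) = Ex mu X - Ex mu Z.
Proof. by move=> iX iZ; exact: RintegralB. Qed.

Lemma ae_eq_Ex {d : measure_display} {T : measurableType d} {R : realType}
    (mu : {measure set T -> \bar R}) (X Z : T -> R) (N : set T) :
  measurable_fun [set: T] X -> measurable_fun [set: T] Z ->
  mu.-negligible N -> (forall v, ~ N v -> X v = Z v) -> Ex mu X = Ex mu Z.
Proof.
move=> mX mZ nN XZ; congr fine; apply: ae_eq_integral => //.
- exact/measurable_EFinP.
- exact/measurable_EFinP.
- apply: negligibleS nN => v /= nXZ; apply: contrapT => nNv.
  by apply: nXZ => _; rewrite XZ.
Qed.

(** For almost every [w] in the group, the kernel at [D w] charges only points of the group with
    dose [D w]. There [psi (D v)] is the constant [psi (D w)], which leaves the inner integral and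
    multiplies [m (D w)]. *)
Lemma cond_kernel_Ex {dT : measure_display} {T : measurableType dT}
    {R : realType} (P : probability T R) (G : T -> nat) (D : T -> R) (g : nat)
    (k : R -> probability T R) (a b M : R) (m psi : R -> R) (X : T -> R) :
  measurable (evG G g) -> measurable_fun [set: T] D -> is_cond_kernel P G D g k ->
  (forall w, G w = g -> a <= D w <= b) ->
  P.-integrable [set: T] (EFin \o X) ->
  (forall x, a <= x <= b -> (k x).-integrable [set: T] (EFin \o X)) ->
  measurable_fun [set: R] psi ->
  (forall x, a <= x <= b -> `|psi x| <= M) -> 0 <= M ->
  {within `[a, b], continuous m} ->
  {ae P, forall w, G w = g -> Ex (k (D w)) X = m (D w)} ->
  Ex P (fun w => X w * (psi (D w) * \1_(evG G g) w)) =
  Ex P (fun w => m (D w) * (psi (D w) * \1_(evG G g) w)).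
Proof.
move=> mG mD hk Dab iX kX mpsi bpsi M0 cm hm.
pose phi w := psi (D w) * \1_(evG G g) w.
have phi0 w : ~ evG G g w -> phi w = 0.
  by move=> nw; rewrite /phi indicE memNset// mulr0.
have bphi w : `|phi w| <= M.
  have [Gw|nGw] := pselect (evG G g w); last by rewrite phi0// normr0.
  by rewrite /phi indicE mem_set// mulr1; exact/bpsi/Dab.
have mphi : measurable_fun [set: T] phi.
  apply: measurable_funM; last exact: measurable_indic.
  exact: (measurableT_comp mpsi mD).
have mX := (measurable_EFinP _ _).1 (measurable_int _ iX).
congr fine; apply: (cond_kernel_integral P G D g k) => //.
- exact: (integrable_mul_bounded P X phi M).
- by move=> w nw; rewrite -/(phi w) phi0// mulr0.
- apply/measurable_EFinP.
  rewrite (_ : (fun w => _) = (fun w => (m (D w) * \1_(evG G g) w) * psi (D w))); last first.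
    by apply/funext => w; rewrite [psi _ * _]mulrC mulrA.
  apply: measurable_funM; last exact: (measurableT_comp mpsi mD).
  exact: (measurable_comp_on D (evG G g) a b m).
- by move=> w nw; rewrite -/(phi w) phi0// mulr0.
have hc := cond_kernel_concentrated P G D g k mG mD hk.
apply: filterS2 hm hc => w hm hc Gw.
have ik : (k (D w)).-integrable [set: T] (EFin \o (fun v => X v * phi v)).
  by apply: (integrable_mul_bounded _ X phi M) => //; apply: kX; exact: Dab.
rewrite -/(EFin \o (fun v => X v * phi v)) ExE//; congr EFin.
rewrite (@ae_eq_Ex _ _ _ _ _ (fun v => X v * psi (D w)) _ _ _ (hc Gw)).
- rewrite -/(phi w) /phi indicE mem_set// mulr1 -hm//.
  by apply: RintegralZr => //; apply: kX; exact: Dab.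
- exact: measurable_funM.
- by apply: measurable_funM => //; exact: measurable_cst.
- move=> v /contrapT [Gv Dv]; congr (_ * _).
  by rewrite /phi indicE mem_set// mulr1 Dv.
Qed.

(** The layer-cake formula with [phi] equal to [psi (D w)] restricted to the group; the group
    indicator and the level indicator merge into that of [evGge]. *)
Lemma group_layer_cake {dT : measure_display} {T : measurableType dT}
    {R : realType} (P : probability T R) (G : T -> nat) (D : T -> R) (g : nat)
    (k : R -> probability T R) (a b M : R) (m m' psi : R -> R) (X : T -> R) :
  measurable (evG G g) -> measurable_fun [set: T] D -> is_cond_kernel P G D g k ->
  (forall w, G w = g -> a <= D w <= b) ->
  P.-integrable [set: T] (EFin \o X) ->
  (forall x, a <= x <= b -> (k x).-integrable [set: T] (EFin \o X)) ->
  measurable_fun [set: R] psi ->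
  (forall x, a <= x <= b -> `|psi x| <= M) -> 0 <= M ->
  {within `[a, b], continuous m} -> {within `[a, b], continuous m'} ->
  (forall x, a <= x <= b ->
     m x = m a + \int[lebesgue_measure]_(l in `[a, x]) m' l) ->
  {ae P, forall w, G w = g -> Ex (k (D w)) X = m (D w)} ->
  Ex P (fun w => X w * (psi (D w) * \1_(evG G g) w)) =
  m a * Ex P (fun w => psi (D w) * \1_(evG G g) w) +
  \int[lebesgue_measure]_(l in `[a, b])
    (Ex P (fun w => psi (D w) * \1_(evGge G D g l) w) * m' l).
Proof.
move=> mG mD hk Dab iX kX mpsi bpsi M0 cm cm' FTC hm.
rewrite (cond_kernel_Ex P G D g k a b M m psi X mG mD hk Dab iX kX mpsi bpsi M0 cm hm).
pose phi w := psi (D w) * \1_(evG G g) w.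
have mphi : measurable_fun [set: T] phi.
  apply: measurable_funM; last exact: measurable_indic.
  exact: (measurableT_comp mpsi mD).
have bphi w : `|phi w| <= M.
  rewrite /phi; have [Gw|nGw] := pselect (evG G g w).
    by rewrite indicE mem_set// mulr1; exact/bpsi/Dab.
  by rewrite indicE memNset// mulr0 normr0.
have Dphi w : phi w != 0 -> a <= D w <= b.
  rewrite /phi; have [Gw _|nGw] := pselect (evG G g w); first exact: Dab.
  by rewrite indicE memNset// mulr0 eqxx.
have -> := layer_cake P D phi M a b m m' mD mphi bphi Dphi cm' FTC.
apply: congr1; apply: eq_Rintegral => l _.
have -> // : (fun w => phi w * \1_[set v | l <= D v] w) =
  (fun w => psi (D w) * \1_(evGge G D g l) w).
apply/funext => w; rewrite /phi -mulrA.
have -> : evGge G D g l = evG G g `&` [set v | l <= D v] by [].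
by rewrite indicI.
Qed.

(** * Window averages *)

(** Scalar counterpart of [wavg]: at a fixed sample point [wavg] unfolds to it, and it also averages
    expectations over periods. *)
Definition avg {R : realType} (e : nat -> R) (A : nat * nat) : R :=
  (\sum_(A.1 <= t < A.2.+1) e t) / (A.2 - A.1).+1%:R.

Lemma eq_avg {R : realType} (e e' : nat -> R) (A : nat * nat) :
  (forall t, (A.1 <= t <= A.2)%N -> e t = e' t) -> avg e A = avg e' A.
Proof.
move=> ee'; rewrite /avg; congr (_ / _).
by rewrite !big_nat; apply: eq_bigr => t; rewrite ltnS; exact: ee'.
Qed.

Lemma avgB {R : realType} (e e' : nat -> R) (A : nat * nat) :
  avg (fun t => e t - e' t) A = avg e A - avg e' A.
Proof. by rewrite /avg sumrB mulrBl. Qed.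

Lemma avg_cst {R : realType} (c : R) (A : nat * nat) :
  (A.1 <= A.2)%N -> avg (fun=> c) A = c.
Proof.
move=> A12; rewrite /avg sumr_const_nat subSn// -[c *+ _]mulr_natr mulfK//.
Qed.

(** Telescoping passes from parallel trends period by period to a constant gap between the two
    paths. *)
Lemma eq_increments {R : realType} (n : nat) (e e' : nat -> R) :
  (forall t, (2 <= t <= n)%N -> e t - e t.-1 = e' t - e' t.-1) ->
  forall t, (1 <= t <= n)%N -> e t - e' t = e 1%N - e' 1%N.
Proof.
move=> ee'; elim=> // -[//|t] IH /andP[_ tn].
have {}IH : e t.+1 - e' t.+1 = e 1%N - e' 1%N by apply: IH; rewrite /= ltnW.
have /= h := ee' t.+2 tn; rewrite -IH.
have -> : e t.+2 = (e t.+2 - e t.+1) + e t.+1 by rewrite subrK.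
by rewrite h; ring.
Qed.

(** The constant gap between the paths enters both window averages and cancels in their
    difference. *)
Lemma eq_increments_avg {R : realType} (n : nat) (e e' : nat -> R)
    (A B : nat * nat) :
  (forall t, (2 <= t <= n)%N -> e t - e t.-1 = e' t - e' t.-1) ->
  (1 <= A.1 <= A.2)%N -> (A.2 <= n)%N -> (1 <= B.1 <= B.2)%N -> (B.2 <= n)%N ->
  avg e A - avg e B = avg e' A - avg e' B.
Proof.
move=> ee' /andP[A1 A12] An /andP[B1 B12] Bn.
have h C : (1 <= C.1)%N -> (C.1 <= C.2)%N -> (C.2 <= n)%N ->
    avg e C - avg e' C = e 1%N - e' 1%N.
  move=> C1 C12 Cn; rewrite -avgB -[RHS](avg_cst _ C)//.
  apply: eq_avg => t /andP[Ct tC]; apply: (eq_increments n) => //.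
  by rewrite (leq_trans C1 Ct) (leq_trans tC Cn).
have hA := h A A1 A12 An; have hB := h B B1 B12 Bn.
have -> : avg e A = avg e' A + (e 1%N - e' 1%N) by rewrite -hA subrKC.
have -> : avg e B = avg e' B + (e 1%N - e' 1%N) by rewrite -hB subrKC.
by ring.
Qed.

(** Regularity is known for one-period changes, not for levels. Subtracting the first-period level
    in both windows expresses everything through telescoped changes, and that level cancels. *)
Lemma C1_on_avg_increments {R : realType} (a b : R) (n : nat)
    (e : nat -> R -> R) (A B : nat * nat) :
  (forall t, (2 <= t <= n)%N -> C1_on a b (fun x => e t x - e t.-1 x)) ->
  (1 <= A.1 <= A.2)%N -> (A.2 <= n)%N -> (1 <= B.1 <= B.2)%N -> (B.2 <= n)%N ->
  C1_on a b (fun x => avg (e^~ x) A - avg (e^~ x) B).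
Proof.
move=> eC /andP[A1 A12] An /andP[B1 B12] Bn.
have h t : (1 <= t <= n)%N -> C1_on a b (fun x => e t x - e 1%N x).
  elim: t => // -[_ _|t IH /andP[_ tn]].
    by apply: (C1_on_ext _ (C1_on_cst a b 0)) => x _; rewrite subrr.
  have {}IH := IH (ltnW tn).
  apply: (C1_on_ext _ (C1_onD _ _ _ _ (eC t.+2 tn) IH)) => x _ /=; ring.
have hC C : (1 <= C.1)%N -> (C.1 <= C.2)%N -> (C.2 <= n)%N ->
    C1_on a b (fun x => avg (fun t => e t x - e 1%N x) C).
  move=> C1 C12 Cn.
  have : C1_on a b (fun x => \sum_(t <- index_iota C.1 C.2.+1) (e t x - e 1%N x)).
    apply: C1_on_sum => t; rewrite mem_index_iota ltnS => /andP[Ct tC].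
    by apply: h; rewrite (leq_trans C1 Ct) (leq_trans tC Cn).
  move/(C1_onZ a b (C.2 - C.1).+1%:R^-1).
  by apply: C1_on_ext => x _; rewrite mulrC.
have := C1_onD _ _ _ _ (hC A A1 A12 An) (C1_onZ _ _ (-1) _ (hC B B1 B12 Bn)).
by apply: C1_on_ext => x _; rewrite !avgB !avg_cst//; ring.
Qed.

Lemma integrable_avg {d : measure_display} {T : measurableType d} {R : realType}
    (mu : {measure set T -> \bar R}) (Z : nat -> T -> R) (A : nat * nat) :
  (forall t, (A.1 <= t <= A.2)%N -> mu.-integrable [set: T] (EFin \o Z t)) ->
  mu.-integrable [set: T] (EFin \o (wavg Z A)) /\
  Ex mu (wavg Z A) = avg (fun t => Ex mu (Z t)) A.
Proof.
move=> iZ.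
have h (s : seq nat) : (forall t, t \in s -> mu.-integrable [set: T] (EFin \o Z t)) ->
    mu.-integrable [set: T] (EFin \o (fun w => \sum_(t <- s) Z t w)) /\
    Ex mu (fun w => \sum_(t <- s) Z t w) = \sum_(t <- s) Ex mu (Z t).
  elim: s => [_|t s IH its].
    have E0 : (fun w : T => \sum_(t <- [::]) Z t w) = (fun=> 0).
      by apply/funext => w; rewrite big_nil.
    rewrite E0 big_nil; split; first exact: integrable0.
    by rewrite /Ex integral0.
  have [|iS ES] := IH; first by move=> i si; apply: its; rewrite in_cons si orbT.
  have it := its t (mem_head _ _).
  have E1 : (fun w : T => \sum_(t <- t :: s) Z t w) =
      (fun w => Z t w + \sum_(t <- s) Z t w).
    by apply/funext => w; rewrite big_cons.
  rewrite E1 big_cons -ES; split; last exact: RintegralD.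
  exact: (integrableD measurableT it iS).
have [|iS ES] := h (index_iota A.1 A.2.+1).
  by move=> t; rewrite mem_index_iota ltnS; exact: iZ.
split; last by rewrite /avg -ES; exact: RintegralZr.
exact: (integrableZr measurableT _ iS).
Qed.

(** Domination by 1 + X^2, integrable under a probability; the inequality comes from the square of
    |X| - 1/2. *)
Lemma integrable_of_sqr {d : measure_display} {T : measurableType d}
    {R : realType} (P : probability T R) (X : T -> R) :
  measurable_fun [set: T] X ->
  P.-integrable [set: T] (fun w => (X w ^+ 2)%:E) ->
  P.-integrable [set: T] (EFin \o X).
Proof.
move=> mX iX2.
have i1 : P.-integrable [set: T] (EFin \o (cst 1 : T -> R)).
  exact: finite_measure_integrable_cst.
have i := integrableD measurableT i1 iX2.
apply: le_integrable i => //; first exact/measurable_EFinP.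
move=> w _ /=; rewrite lee_fin [leRHS]ger0_norm; last first.
  by rewrite addr_ge0// sqr_ge0.
rewrite -[X w ^+ 2]real_normK ?num_real//.
have := sqr_ge0 (`|X w| - 2^-1); nra.
Qed.

Lemma CE_wavgB {d : measure_display} {T : measurableType d} {R : realType}
    (P : probability T R) (Z : nat -> T -> R) (E : set T) (A B : nat * nat) :
  measurable E ->
  (forall t, (A.1 <= t <= A.2)%N -> P.-integrable [set: T] (EFin \o Z t)) ->
  (forall t, (B.1 <= t <= B.2)%N -> P.-integrable [set: T] (EFin \o Z t)) ->
  CE P (fun w => wavg Z A w - wavg Z B w) E =
  avg (fun t => CE P (Z t) E) A - avg (fun t => CE P (Z t) E) B.
Proof.
move=> mE iA iB.
pose ZE t w := Z t w * \1_E w.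
have iZE t : P.-integrable [set: T] (EFin \o Z t) -> P.-integrable [set: T] (EFin \o ZE t).
  move=> iZ; apply: (integrable_mul_bounded P (Z t) \1_E 1) => //.
  by move=> w; rewrite indicE; case: (w \in E); rewrite ?normr1 ?normr0.
have sc C : avg (fun t => CE P (Z t) E) C = avg (fun t => Ex P (ZE t)) C / Pr P E.
  by rewrite /avg -mulr_suml mulrAC.
have [jA eA] := integrable_avg P ZE A (fun t h => iZE t (iA t h)).
have [jB eB] := integrable_avg P ZE B (fun t h => iZE t (iB t h)).
rewrite !sc -mulrBl -eA -eB -ExB//; congr (Ex P _ / _).
by apply/funext => w; rewrite /wavg /ZE mulrBl -!mulr_suml ![_ / _ * \1_E w]mulrAC.
Qed.

(** * Support points, null sets and conditional expectations *)

Lemma ae_level_dense {dT : measure_display} {T : measurableType dT}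
    {R : realType} (P : probability T R) (G : T -> nat) (D : T -> R) (g : nat)
    (a b : R) (Q : R -> Prop) :
  (forall w, G w = g -> a <= D w <= b) ->
  (forall x, a <= x <= b -> forall e, 0 < e ->
     (0 < P [set w | G w = g /\ (`|D w - x| < e)%R])%E) ->
  measurable (evG G g) -> measurable_fun [set: T] D ->
  {ae P, forall w, G w = g -> Q (D w)} ->
  forall x e, a <= x <= b -> 0 < e ->
  exists2 y, Q y & (a <= y <= b) /\ `|y - x| < e.
Proof.
move=> Dab supp mG mD [N [mN N0 sN]] x e xab e0.
(* If no such dose existed, the event that [G w = g] and [D w] is within [e] of [x], which has
   positive probability by the support condition, would lie in the null set [N]. *)
apply: contrapT => nex.
have := supp x xab e e0; rewrite lt_neqAle => /andP[/negP + _]; apply.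
apply/eqP/esym; apply: (subset_measure0 _ mN _ N0).
  have := measurable_level_set G D g (ball x e) mG mD (measurable_ball _ _).
  by congr measurable; apply/seteqP; split => w /=; rewrite /ball /= distrC.
move=> w /= [Gw Dw]; apply: sN => h; apply: nex.
by exists (D w); [exact: h|split => //; exact: Dab].
Qed.

(** The endpoints are Lebesgue-null. This is what allows [derive1], identified only at interior
    doses, inside integrals over the closed interval. *)
Lemma Rintegral_eq_oo {R : realType} (a b : R) (f h : R -> R) :
  (forall x, a < x < b -> f x = h x) ->
  lebesgue_measure.-integrable `[a, b] (EFin \o h) ->
  \int[lebesgue_measure]_(x in `[a, b]) f x =
  \int[lebesgue_measure]_(x in `[a, b]) h x.
Proof.
move=> fh ih.
have mh : measurable_fun `]a, b[ (EFin \o h).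
  apply: measurable_funS (measurable_int _ ih) => //.
  exact: subset_itv_oo_cc.
have fh' : {in `]a, b[%classic, EFin \o f =1 EFin \o h}.
  by move=> x /set_mem /=; rewrite in_itv /= => /fh ->.
have mf : measurable_fun `]a, b[ (EFin \o f).
  by apply: eq_measurable_fun mh => x xab; rewrite fh'.
rewrite /Rintegral (@integral_itv_bndoo _ _ _ (EFin \o f) true false)//.
rewrite (@integral_itv_bndoo _ _ _ (EFin \o h) true false)//; congr fine.
exact: eq_integral.
Qed.

Lemma derive1_subc {R : realType} (f : R -> R) (c x : R) :
  derive1 (fun y => f y - c) x = derive1 f x.
Proof.
rewrite /derive1 (_ : (fun h => _) = (fun h => h^-1 *: (f (h + x) - f x)))//.
by apply/funext => h; congr (_ *: _); ring.
Qed.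

Lemma Ex_indic {d : measure_display} {T : measurableType d} {R : realType}
    (P : probability T R) (E : set T) : measurable E ->
  Ex P (fun w => 1 * \1_E w) = Pr P E.
Proof.
move=> mE; rewrite /Ex /Pr; congr fine.
by under eq_integral do rewrite mul1r; rewrite integral_indic// setIT.
Qed.

Lemma integrable_mul_indic {d : measure_display} {T : measurableType d}
    {R : realType} (P : probability T R) (E : set T) (phi : T -> R) (M : R) :
  measurable E -> measurable_fun [set: T] phi ->
  (forall w, E w -> `|phi w| <= M) ->
  P.-integrable [set: T] (EFin \o (fun w => phi w * \1_E w)).
Proof.
move=> mE mphi bphi; apply: (integrable_bounded_prob P _ `|M|).
  by apply: measurable_funM => //; exact: measurable_indic.
move=> w; have [Ew|nEw] := pselect (E w).
  by rewrite indicE mem_set// mulr1 (le_trans (bphi w Ew))// ler_norm.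
by rewrite indicE memNset// mulr0 normr0.
Qed.

Lemma Ex_centered_indic {d : measure_display} {T : measurableType d}
    {R : realType} (P : probability T R) (E : set T) (phi : T -> R) (M c : R) :
  measurable E -> measurable_fun [set: T] phi ->
  (forall w, E w -> `|phi w| <= M) ->
  Ex P (fun w => (phi w - c) * \1_E w) =
  Ex P (fun w => phi w * \1_E w) - c * Pr P E.
Proof.
move=> mE mphi bphi.
have ip := integrable_mul_indic P E phi M mE mphi bphi.
have i1 : P.-integrable [set: T] (EFin \o (fun w => 1 * \1_E w)).
  by apply: (integrable_mul_indic P E _ 1) => // w _; rewrite normr1.
have ic : P.-integrable [set: T] (EFin \o (fun w => c * \1_E w)).
  by apply: (integrable_mul_indic P E _ `|c|).
have -> : c * Pr P E = Ex P (fun w => c * \1_E w).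
  rewrite -(Ex_indic P E mE); apply/esym.
  transitivity (Ex P (fun w => c * (1 * \1_E w))); last exact: RintegralZl.
  by congr (Ex P _); apply/funext => w; rewrite mul1r.
by rewrite -ExB//; congr (Ex P _); apply/funext => w; exact: mulrBl.
Qed.

(** Null events are included: there the quotient in [CE] has the default value 0 and the left side
    vanishes too. The event that the dose is at least [l] can be null, for instance at the top
    dose. *)
Lemma Ex_indicE_CE {d : measure_display} {T : measurableType d} {R : realType}
    (P : probability T R) (E : set T) (phi : T -> R) :
  measurable E -> measurable_fun [set: T] phi ->
  Ex P (fun w => phi w * \1_E w) = CE P phi E * Pr P E.
Proof.
move=> mE mphi; rewrite /CE; have [P0|P0] := eqVneq (Pr P E) 0; last by rewrite divfK.
rewrite P0 mulr0 (ae_eq_Ex P _ (fun=> 0) E).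
- by rewrite /Ex integral0.
- by apply: measurable_funM => //; exact: measurable_indic.
- exact: measurable_cst.
- apply/negligibleP => //.
  have PE : P E = (Pr P E)%:E by rewrite /Pr fineK//; exact: fin_num_measure.
  exact: etrans PE (congr1 EFin P0).
- by move=> w nE; rewrite indicE memNset// mulr0.
Qed.

Lemma CEB {d : measure_display} {T : measurableType d} {R : realType}
    (P : probability T R) (X Z : T -> R) (E : set T) : measurable E ->
  P.-integrable [set: T] (EFin \o X) -> P.-integrable [set: T] (EFin \o Z) ->
  CE P (fun w => X w - Z w) E = CE P X E - CE P Z E.
Proof.
move=> mE iX iZ.
have m1 : measurable_fun [set: T] (\1_E : T -> R) by exact: measurable_indic.
have b1 (w : T) : `|\1_E w| <= 1 :> R.
  by rewrite indicE; case: (w \in E); rewrite ?normr1 ?normr0.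
rewrite /CE -mulrBl -ExB.
- by congr (Ex P _ / _); apply/funext => w; rewrite mulrBl.
- exact: (integrable_mul_bounded P X \1_E 1).
- exact: (integrable_mul_bounded P Z \1_E 1).
Qed.

Lemma Rintegral_eq_ooZr {R : realType} (a b c : R) (f h : R -> R) :
  (forall x, a < x < b -> f x = h x * c) ->
  lebesgue_measure.-integrable `[a, b] (EFin \o h) ->
  \int[lebesgue_measure]_(x in `[a, b]) f x =
  (\int[lebesgue_measure]_(x in `[a, b]) h x) * c.
Proof.
move=> fh ih; rewrite -RintegralZr//; apply: Rintegral_eq_oo fh _.
have -> : EFin \o (fun x => h x * c) = (fun x => (EFin \o h) x * c%:E)%E by [].
exact: integrableZr.
Qed.

(** * Window comparisons within a timing group *)

(** A zero dose means [G w = Tn.+1], later than every period of a window, so the observed outcomes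
    are the untreated ones. *)
Lemma never_treated_means {dT : measure_display} {T : measurableType dT}
    {R : realType} (P : probability T R) (Tn : nat) (G : T -> nat) (D : T -> R)
    (Y : nat -> nat -> R -> T -> R) (A B : nat * nat) :
  measurable_fun [set: T] D -> (forall w, D w = 0 <-> G w = Tn.+1) ->
  (forall t, (1 <= t <= Tn)%N -> P.-integrable [set: T] (EFin \o Y0 Y Tn t)) ->
  (1 <= A.1 <= A.2)%N -> (A.2 <= Tn)%N -> (1 <= B.1 <= B.2)%N -> (B.2 <= Tn)%N ->
  CE P (fun w => wavg (Yobs Y G D Tn) A w - wavg (Yobs Y G D Tn) B w) (evD0 D) =
  avg (fun t => CE P (Y0 Y Tn t) (evD0 D)) A -
  avg (fun t => CE P (Y0 Y Tn t) (evD0 D)) B.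
Proof.
move=> mD hD0 iY0 /andP[A1 A12] An /andP[B1 B12] Bn.
have mE : measurable (evD0 D).
  have := mD measurableT [set 0] (measurable_set1 _).
  by rewrite setTI.
rewrite -CE_wavgB//.
- congr (Ex P _ / _); apply/funext => w.
  have [Dw|nDw] := pselect (evD0 D w); last by rewrite indicE memNset// !mulr0.
  have Gw : G w = Tn.+1 by apply/hD0.
  have E C : (C.2 <= Tn)%N -> wavg (Yobs Y G D Tn) C w = wavg (Y0 Y Tn) C w.
    move=> Cn; apply: (eq_avg (Yobs Y G D Tn ^~ w)) => t /andP[_ tC].
    by rewrite /Yobs Gw ltnS (leq_trans tC Cn).
  by rewrite !E.
- by move=> t /andP[At tA]; apply: iY0; rewrite (leq_trans A1 At) (leq_trans tA An).
- by move=> t /andP[Bt tB]; apply: iY0; rewrite (leq_trans B1 Bt) (leq_trans tB Bn).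
Qed.

Section TimingGroup.
Context {dT : measure_display} {T : measurableType dT} {R : realType}.
Context (P : probability T R) (Tn : nat) (G : T -> nat) (D : T -> R) (dL dU : R).
Context (Y : nat -> nat -> R -> T -> R) (kern : nat -> R -> probability T R).
Context (g : nat).
Context (mG : measurable (evG G g)) (mD : measurable_fun [set: T] D).
Context (Dg : forall w, G w = g -> dL <= D w <= dU).
Context (supp : forall x, dL <= x <= dU -> forall e, 0 < e ->
  (0 < P [set w | G w = g /\ (`|D w - x| < e)%R])%E).
Context (mYobs : forall t, (1 <= t <= Tn)%N -> measurable_fun [set: T] (Yobs Y G D Tn t)).
Context (mY0 : forall t, (1 <= t <= Tn)%N -> measurable_fun [set: T] (Y0 Y Tn t)).
Context (mY : forall t a, (1 <= t <= Tn)%N -> dL <= a <= dU ->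
  measurable_fun [set: T] (Y t g a)).
Context (iYobs : forall t, (1 <= t <= Tn)%N -> P.-integrable [set: T] (EFin \o Yobs Y G D Tn t)).
Context (hk : is_cond_kernel P G D g (kern g)).
Context (kYobs : forall x t, dL <= x <= dU -> (1 <= t <= Tn)%N ->
  (kern g x).-integrable [set: T] (EFin \o Yobs Y G D Tn t)).
Context (kY0 : forall x t, dL <= x <= dU -> (1 <= t <= Tn)%N ->
  (kern g x).-integrable [set: T] (EFin \o Y0 Y Tn t)).
Context (kY : forall x t a, dL <= x <= dU -> (1 <= t <= Tn)%N -> dL <= a <= dU ->
  (kern g x).-integrable [set: T] (EFin \o Y t g a)).
Context (hC1 : forall t, (2 <= t <= Tn)%N ->
  C1_on dL dU (fun x => Ex (kern g x)
                 (fun w => Yobs Y G D Tn t w - Yobs Y G D Tn t.-1 w))).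
(* [c0 t] stands for the mean of Y_t(0) among never-treated units. *)
Context (c0 : nat -> R).
Context (hPT : forall t x, (2 <= t <= Tn)%N -> dL <= x <= dU ->
  Ex (kern g x) (fun w => Y0 Y Tn t w - Y0 Y Tn t.-1 w) = c0 t - c0 t.-1).

Let Yo := Yobs Y G D Tn.
Let X (A B : nat * nat) (w : T) : R := wavg Yo A w - wavg Yo B w.
Let win (A : nat * nat) := [&& (1 <= A.1)%N, (A.1 <= A.2)%N & (A.2 <= Tn)%N].

Let win_mem A t : win A -> (A.1 <= t <= A.2)%N -> (1 <= t <= Tn)%N.
Proof.
move=> /and3P[A1 _ An] /andP[At tA].
by rewrite (leq_trans A1 At) (leq_trans tA An).
Qed.

Lemma integrable_window_diff (mu : {measure set T -> \bar R}) (A B : nat * nat) :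
  (forall t, (1 <= t <= Tn)%N -> mu.-integrable [set: T] (EFin \o Yo t)) ->
  win A -> win B -> mu.-integrable [set: T] (EFin \o X A B) /\
  Ex mu (X A B) = avg (fun t => Ex mu (Yo t)) A - avg (fun t => Ex mu (Yo t)) B.
Proof.
move=> iY wA wB.
have [iA eA] := integrable_avg mu Yo A (fun t h => iY t (win_mem A t wA h)).
have [iB eB] := integrable_avg mu Yo B (fun t h => iY t (win_mem B t wB h)).
split; last by rewrite -eA -eB; exact: ExB.
exact: (integrableB measurableT iA iB).
Qed.

Lemma C1_window_diff (A B : nat * nat) : dL < dU -> win A -> win B ->
  C1_on dL dU (fun x => Ex (kern g x) (X A B)).
Proof.
move=> dLU wA wB; have /and3P[A1 A12 An] := wA; have /and3P[B1 B12 Bn] := wB.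
have := C1_on_avg_increments dL dU Tn (fun t x => Ex (kern g x) (Yo t)) A B.
move=> C1; have {}C1 : C1_on dL dU (fun x => avg (fun t => Ex (kern g x) (Yo t)) A -
    avg (fun t => Ex (kern g x) (Yo t)) B).
  apply: C1; rewrite ?A1 ?B1//.
  move=> [|[|t]]// /andP[_ tn]; apply: C1_on_ext (hC1 t.+2 tn) => x xab.
  by rewrite ExB//; apply: kYobs; rewrite //= ltnW.
apply: C1_on_ext C1 => x xab.
by have [_ ->] := integrable_window_diff (kern g x) A B (fun t => kYobs x t xab) wA wB.
Qed.

(** The kernel at [D w] sits on the points of the group with dose [D w], where the switching rule
    for observed outcomes is deterministic. One exceptional null set serves all periods. *)
Lemma cond_kernel_outcomes :
  {ae P, forall w, G w = g -> forall t, (1 <= t <= Tn)%N ->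
     Ex (kern g (D w)) (Yo t) =
     if (t < g)%N then Ex (kern g (D w)) (Y0 Y Tn t)
     else Ex (kern g (D w)) (Y t g (D w))}.
Proof.
apply: filterS (cond_kernel_concentrated P G D g (kern g) mG mD hk) => w hw Gw t tn.
have {}hw := hw Gw; have Dw := Dg w Gw.
case: ifP => tg; apply: (ae_eq_Ex _ _ _ _ _ _ hw).
- exact: mYobs.
- exact: mY0.
- by move=> v /contrapT[Gv _]; rewrite /Yo /Yobs Gv tg.
- exact: mYobs.
- exact: mY.
- by move=> v /contrapT[Gv Dv]; rewrite /Yo /Yobs Gv tg Dv.
Qed.

Lemma untreated_trend (A B : nat * nat) x : win A -> win B -> dL <= x <= dU ->
  avg (fun t => Ex (kern g x) (Y0 Y Tn t)) A -
  avg (fun t => Ex (kern g x) (Y0 Y Tn t)) B = avg c0 A - avg c0 B.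
Proof.
move=> /and3P[A1 A12 An] /and3P[B1 B12 Bn] xab.
apply: (eq_increments_avg Tn); rewrite ?A1 ?B1//.
move=> [|[|t]]// /andP[_ tn]; have /= <- := hPT t.+2 x tn xab.
by rewrite ExB//; apply: kY0; rewrite //= ltnW.
Qed.

Lemma ATTbarE (A : nat * nat) x a : win A -> dL <= x <= dU -> dL <= a <= dU ->
  ATTbar Y Tn kern A g a x =
  avg (fun t => Ex (kern g x) (Y t g a)) A - avg (fun t => Ex (kern g x) (Y0 Y Tn t)) A.
Proof.
move=> wA xab aab; rewrite /ATTbar.
have iY t : (A.1 <= t <= A.2)%N -> (kern g x).-integrable [set: T]
    (EFin \o (fun w => Y t g a w - Y0 Y Tn t w)).
  move=> /(win_mem A t wA) tn.
  exact: (integrableB measurableT (kY x t a xab tn aab) (kY0 x t xab tn)).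
have [_ ->] := integrable_avg _ _ A iY.
rewrite -avgB; apply: eq_avg => t /(win_mem A t wA) tn.
by rewrite ExB//; [exact: kY|exact: kY0].
Qed.

Lemma pretreatment_window_diff (A B : nat * nat) : win A -> win B ->
  (A.2 < g)%N -> (B.2 < g)%N ->
  {ae P, forall w, G w = g -> Ex (kern g (D w)) (X A B) = avg c0 A - avg c0 B}.
Proof.
move=> wA wB Ag Bg; apply: filterS cond_kernel_outcomes => w hw Gw.
have Dw := Dg w Gw; have {}hw := hw Gw.
have [_ ->] := integrable_window_diff (kern g (D w)) A B (fun t => kYobs (D w) t Dw) wA wB.
rewrite -(untreated_trend A B (D w))//; congr (_ - _); apply: eq_avg => t tA.
  by rewrite hw ?(win_mem A)//; case/andP: tA => _ tA; rewrite (leq_ltn_trans tA Ag).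
by rewrite hw ?(win_mem B)//; case/andP: tA => _ tB; rewrite (leq_ltn_trans tB Bg).
Qed.

Lemma posttreatment_window_diff_ae (A B : nat * nat) : win A -> win B ->
  (g <= A.1)%N -> (B.2 < g)%N ->
  {ae P, forall w, G w = g -> Ex (kern g (D w)) (X A B) =
     ATTbar Y Tn kern A g (D w) (D w) + (avg c0 A - avg c0 B)}.
Proof.
move=> wA wB Ag Bg; apply: filterS cond_kernel_outcomes => w hw Gw.
have Dw := Dg w Gw; have {}hw := hw Gw.
have [_ ->] := integrable_window_diff (kern g (D w)) A B (fun t => kYobs (D w) t Dw) wA wB.
(* The untreated average over [A] is subtracted in the treatment effect and added back in the
   untreated trend; what remains is treated outcomes over [A] minus untreated outcomes over [B]. *)
rewrite -(untreated_trend A B (D w))// ATTbarE// subrKA; congr (_ - _).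
  apply: eq_avg => t tA; rewrite hw ?(win_mem A)//.
  by case/andP: tA => At _; rewrite ltnNge (leq_trans Ag At).
apply: eq_avg => t tA.
by rewrite hw ?(win_mem B)//; case/andP: tA => _ tB; rewrite (leq_ltn_trans tB Bg).
Qed.

(** Continuity of both sides and density of the good doses extend the identity to every dose,
    including [dL], which may itself carry no mass. *)
Lemma posttreatment_window_diff (A B : nat * nat) x : dL < dU -> win A -> win B ->
  (g <= A.1)%N -> (B.2 < g)%N ->
  diff_on_square dL dU (ATTbar Y Tn kern A g) -> dL <= x <= dU ->
  Ex (kern g x) (X A B) = ATTbar Y Tn kern A g x x + (avg c0 A - avg c0 B).
Proof.
move=> dLU wA wB Ag Bg [cF _].
pose h x := ATTbar Y Tn kern A g x x + (avg c0 A - avg c0 B).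
have ch : {within `[dL, dU], continuous h}.
  move=> y; apply: cvgD; last exact: cvg_cst.
  exact: (within_diag_continuous dL dU _ cF).
have [cm _] := C1_window_diff A B dLU wA wB.
apply: (within_continuous_dense_eq dL dU _ h
  (fun y => Ex (kern g y) (X A B) = h y) cm ch) => //.
apply: (ae_level_dense P G D g dL dU _ Dg supp mG mD).
exact: posttreatment_window_diff_ae.
Qed.

Lemma measurable_evGge l : measurable (evGge G D g l).
Proof.
have := measurable_level_set G D g `[l, +oo[ mG mD (measurable_itv _).
by congr measurable; apply/seteqP; split => w /=; rewrite in_itv /= andbT.
Qed.

Lemma integrable_group_survival (M : R) (psi m' : R -> R) :
  measurable_fun [set: R] psi ->
  (forall x, dL <= x <= dU -> `|psi x| <= M) -> 0 <= M ->
  {within `[dL, dU], continuous m'} ->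
  lebesgue_measure.-integrable `[dL, dU] (EFin \o (fun l =>
    Ex P (fun w => psi (D w) * \1_(evGge G D g l) w) * m' l)).
Proof.
move=> mpsi bpsi M0 cm'.
pose phi w := psi (D w) * \1_(evG G g) w.
have mphi : measurable_fun [set: T] phi.
  apply: measurable_funM; last exact: measurable_indic.
  exact: (measurableT_comp mpsi mD).
have bphi w : `|phi w| <= M.
  rewrite /phi; have [Gw|nGw] := pselect (evG G g w).
    by rewrite indicE mem_set// mulr1; exact/bpsi/Dg.
  by rewrite indicE memNset// mulr0 normr0.
have := integrable_survival P D phi M dL dU m' mD mphi bphi cm'.
have -> // : (fun l => Ex P (fun w => phi w * \1_[set v | l <= D v] w) * m' l) =
  (fun l => Ex P (fun w => psi (D w) * \1_(evGge G D g l) w) * m' l).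
apply/funext => l.
have -> // : (fun w => phi w * \1_[set v | l <= D v] w) =
  (fun w => psi (D w) * \1_(evGge G D g l) w).
apply/funext => w; rewrite /phi -mulrA.
have -> : evGge G D g l = evG G g `&` [set v | l <= D v] by [].
by rewrite indicI.
Qed.

Lemma integrable_PDge (m' : R -> R) : {within `[dL, dU], continuous m'} ->
  lebesgue_measure.-integrable `[dL, dU] (EFin \o (fun l => PDge P G D g l * m' l)).
Proof.
move=> cm'.
have b1 : forall x : R, dL <= x <= dU -> `|(1 : R)| <= 1 by move=> x _; rewrite normr1.
have iS := integrable_group_survival 1 (fun=> 1) m' (measurable_cst _) b1 ler01 cm'.
pose S l := Ex P (fun w => 1 * \1_(evGge G D g l) w) * m' l.
have -> : EFin \o (fun l => PDge P G D g l * m' l) =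
    (fun l => ((Pr P (evG G g))^-1)%:E * (S l)%:E)%E.
  apply/funext => l; rewrite /= -EFinM /S Ex_indic; last exact: measurable_evGge.
  by congr EFin; rewrite /PDge; ring.
by apply: integrableZl => //; exact: iS.
Qed.

(** The support condition at [dL] with radius 1 already gives the group positive mass. *)
Lemma Pr_group_neq0 : dL < dU -> Pr P (evG G g) != 0.
Proof.
move=> dLU; have dLin : dL <= dL <= dU by rewrite lexx ltW.
have := supp dL dLin 1 ltr01 => P0; apply/eqP => E0.
have : (0 < P (evG G g))%E.
  apply: lt_le_trans P0 _; apply: le_measure; rewrite ?inE//.
    have := measurable_level_set G D g (ball dL 1) mG mD (measurable_ball _ _).
    by congr measurable; apply/seteqP; split => w /=; rewrite /ball /= distrC.
  by move=> w [].
rewrite -[P _]fineK; last exact: fin_num_measure.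
by rewrite lte_fin -/(Pr P (evG G g)) E0 ltxx.
Qed.

(** Here [m] is the kernel mean itself, so its almost-sure identification is reflexivity; the step
    is purely about observed outcomes, and causal content enters only through [m'] and the value at
    [dL]. *)
Lemma window_diff_expectation (A B : nat * nat) (M : R) (psi m' : R -> R) :
  dL < dU -> win A -> win B -> measurable_fun [set: R] psi ->
  (forall x, dL <= x <= dU -> `|psi x| <= M) -> 0 <= M ->
  {within `[dL, dU], continuous m'} ->
  (forall x, dL < x < dU -> derive1 (fun x => Ex (kern g x) (X A B)) x = m' x) ->
  Ex P (fun w => X A B w * (psi (D w) * \1_(evG G g) w)) =
  Ex (kern g dL) (X A B) * Ex P (fun w => psi (D w) * \1_(evG G g) w) +
  \int[lebesgue_measure]_(l in `[dL, dU])
    (Ex P (fun w => psi (D w) * \1_(evGge G D g l) w) * m' l).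
Proof.
move=> dLU wA wB mpsi bpsi M0 cm' dm.
have [cm [der _]] := C1_window_diff A B dLU wA wB.
have FTC := C1_on_FTC dL dU _ m' cm der cm' dm.
have [iX _] := integrable_window_diff P A B iYobs wA wB.
have kX x (xab : dL <= x <= dU) : (kern g x).-integrable [set: T] (EFin \o X A B).
  by have [] := integrable_window_diff (kern g x) A B (fun t => kYobs x t xab) wA wB.
exact: (group_layer_cake P G D g (kern g) dL dU M _ m' psi (X A B) mG mD hk Dg iX kX
  mpsi bpsi M0 cm cm' FTC (aeW P (fun w _ => erefl _))).
Qed.

Lemma window_diff_CE (A B : nat * nat) (m' : R -> R) :
  dL < dU -> win A -> win B -> {within `[dL, dU], continuous m'} ->
  (forall x, dL < x < dU -> derive1 (fun x => Ex (kern g x) (X A B)) x = m' x) ->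
  CE P (X A B) (evG G g) = Ex (kern g dL) (X A B) +
    \int[lebesgue_measure]_(l in `[dL, dU]) (PDge P G D g l * m' l).
Proof.
move=> dLU wA wB cm' dm; have nz := Pr_group_neq0 dLU.
have b1 : forall x : R, dL <= x <= dU -> `|(1 : R)| <= 1 by move=> x _; rewrite normr1.
have := window_diff_expectation A B 1 (fun=> 1) m' dLU wA wB (measurable_cst _) b1 ler01 cm' dm.
rewrite Ex_indic// /CE.
rewrite (_ : (fun w => X A B w * (1 * \1_(evG G g) w)) = (fun w => X A B w * \1_(evG G g) w)).
  move=> ->; rewrite mulrDl mulfK//; congr (_ + _).
  have iS := integrable_group_survival 1 (fun=> 1) m' (measurable_cst _) b1 ler01 cm'.
  rewrite -RintegralZr//; apply: eq_Rintegral => l _.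
  by rewrite Ex_indic; [rewrite /PDge; ring|exact: measurable_evGge].
by apply/funext => w; rewrite mul1r.
Qed.

(** With both windows before treatment, the conditional mean is the same never-treated trend at
    almost every dose, hence also its average over the group. *)
Lemma pretreatment_CE (A B : nat * nat) : dL < dU -> win A -> win B ->
  (A.2 < g)%N -> (B.2 < g)%N ->
  CE P (X A B) (evG G g) = avg c0 A - avg c0 B.
Proof.
move=> dLU wA wB Ag Bg; have nz := Pr_group_neq0 dLU.
have [iX _] := integrable_window_diff P A B iYobs wA wB.
have kX x (xab : dL <= x <= dU) : (kern g x).-integrable [set: T] (EFin \o X A B).
  by have [] := integrable_window_diff (kern g x) A B (fun t => kYobs x t xab) wA wB.
have b1 : forall x : R, dL <= x <= dU -> `|(1 : R)| <= 1 by move=> x _; rewrite normr1.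
pose c := avg c0 A - avg c0 B.
have cc : {within `[dL, dU], continuous (fun=> c)} by have [] := C1_on_cst dL dU c.
have := cond_kernel_Ex P G D g (kern g) dL dU 1 (fun=> c) (fun=> 1) (X A B) mG mD hk Dg
  iX kX (measurable_cst _) b1 ler01 cc (pretreatment_window_diff A B wA wB Ag Bg).
rewrite (_ : (fun w => X A B w * (1 * \1_(evG G g) w)) = (fun w => X A B w * \1_(evG G g) w)).
  rewrite /CE => ->.
  rewrite (_ : Ex P _ = c * Ex P (fun w => 1 * \1_(evG G g) w)).
    by rewrite Ex_indic// mulfK.
  apply: RintegralZl => //.
  apply: (integrable_bounded_prob P _ 1).
    by apply: measurable_funM => //; exact: measurable_indic.
  by move=> w; rewrite mul1r indicE; case: (w \in _); rewrite ?normr1 ?normr0.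
by apply/funext => w; rewrite mul1r.
Qed.

Lemma derive1_window_diff (A B : nat * nat) x : dL < dU -> win A -> win B ->
  (g <= A.1)%N -> (B.2 < g)%N ->
  diff_on_square dL dU (ATTbar Y Tn kern A g) -> dL < x < dU ->
  derive1 (fun x => Ex (kern g x) (X A B)) x =
  ACRTbar Y Tn kern A g x + dATT_h Y Tn kern A g x.
Proof.
move=> dLU wA wB Ag Bg dF xab.
pose c := avg c0 A - avg c0 B.
have := derive1_diag (ATTbar Y Tn kern A g) x (dF.2 x x xab xab).
rewrite /ACRTbar /dATT_h => <-.
rewrite -(derive1_subc _ c); apply: (eq_on_derive1 _ xab) => y /andP[ya yb].
by rewrite posttreatment_window_diff ?addrK// !ltW.
Qed.

(** Multiplying out, the excess of the truncated mean dose over the group mean, times the survival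
    probability, is the expectation of the centred dose on the event that the dose is at least
    [l]. *)
Lemma w1_withinE l : 0 < dL ->
  w1_within P G D g l =
  Ex P (fun w => (D w - CE P D (evG G g)) * \1_(evGge G D g l) w) /
  Pr P (evG G g) / cvar P D (evG G g).
Proof.
move=> dL0; rewrite /w1_within /PDge.
have mE := measurable_evGge l.
rewrite (Ex_centered_indic P _ D dU)//.
  by rewrite Ex_indicE_CE//; ring.
move=> w [Gw _]; have /andP[Dl Du] := Dg w Gw.
by rewrite ger0_norm// (le_trans _ Dl)// ltW.
Qed.

Lemma window_diff_ccov (A B : nat * nat) (m' : R -> R) :
  0 < dL -> dL < dU -> win A -> win B -> {within `[dL, dU], continuous m'} ->
  (forall x, dL < x < dU -> derive1 (fun x => Ex (kern g x) (X A B)) x = m' x) ->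
  ccov P (X A B) D (evG G g) =
    (\int[lebesgue_measure]_(l in `[dL, dU])
      (Ex P (fun w => (D w - CE P D (evG G g)) * \1_(evGge G D g l) w) * m' l)) /
    Pr P (evG G g).
Proof.
move=> dL0 dLU wA wB cm' dm; rewrite /ccov; set d := CE P D (evG G g).
have bD w : evG G g w -> `|D w| <= dU.
  move=> Gw; have /andP[Dl Du] := Dg w Gw.
  by rewrite ger0_norm// (le_trans _ Dl)// ltW.
(* The centred dose has zero mean in the group. This removes the baseline value at [dL], and below
   also the centring constant [x0] of the outcome. *)
have D0 : Ex P (fun w => (D w - d) * \1_(evG G g) w) = 0.
  by rewrite (Ex_centered_indic P _ D dU)// Ex_indicE_CE// subrr.
have bpsi x : dL <= x <= dU -> `|x - d| <= dU + `|d|.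
  move=> /andP[xl xu]; rewrite (le_trans (ler_normB _ _))// lerD2r.
  by rewrite ger0_norm// (le_trans _ xl)// ltW.
have M0 : 0 <= dU + `|d| by rewrite addr_ge0// ltW// (lt_trans dL0 dLU).
have mpsi : measurable_fun [set: R] (fun x : R => x - d).
  by apply: measurable_funB => //; exact: measurable_cst.
have := window_diff_expectation A B _ (fun x => x - d) m' dLU wA wB mpsi bpsi M0 cm' dm.
rewrite D0 mulr0 add0r => <-.
rewrite {1}/CE; congr (_ / _); set x0 := CE P (X A B) _.
pose phi w := (D w - d) * \1_(evG G g) w.
have mphi : measurable_fun [set: T] phi.
  apply: measurable_funM; last exact: measurable_indic.
  by apply: measurable_funB => //; exact: measurable_cst.
have bphi w : `|phi w| <= dU + `|d|.
  rewrite /phi; have [Gw|nGw] := pselect (evG G g w).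
    by rewrite indicE mem_set// mulr1; exact/bpsi/Dg.
  by rewrite indicE memNset// mulr0 normr0.
have iphi := integrable_bounded_prob P phi _ mphi bphi.
have [iX _] := integrable_window_diff P A B iYobs wA wB.
have iXphi := integrable_mul_bounded P (X A B) phi _ iX mphi bphi.
have ixphi : P.-integrable [set: T] (EFin \o (fun w => x0 * phi w)).
  apply: (integrable_bounded_prob P _ (`|x0| * (dU + `|d|))).
    by apply: measurable_funM => //; exact: measurable_cst.
  by move=> w; rewrite normrM ler_wpM2l.
have E0 : Ex P (fun w => x0 * phi w) = 0.
  have -> : Ex P (fun w => x0 * phi w) = x0 * Ex P phi by exact: RintegralZl.
  by rewrite (D0 : Ex P phi = 0) mulr0.
rewrite -[RHS]subr0 -[in RHS]E0 -ExB//; congr (Ex P _); apply/funext => w.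
rewrite /phi; ring.
Qed.

End TimingGroup.

(** * Assembly of the four comparisons *)

Theorem mainTheorem16
  (dT : measure_display) (T : measurableType dT) (R : realType)
  (P : probability T R) (Tn : nat) (Gs : set nat)
  (G : T -> nat) (D : T -> R) (dL dU : R)
  (Y : nat -> nat -> R -> T -> R) (kern : nat -> R -> probability T R)
  (* timing groups G in Gs, a subset of {2, ..., Tn+1} *)
  (hGs : forall g, Gs g -> (2 <= g <= Tn.+1)%N)
  (hG : forall w, Gs (G w))
  (hGmeas : forall g, measurable (evG G g))
  (hDmeas : measurable_fun [set: T] D)
  (* D = 0 exactly for never-treated units, D in D+ = [dL, dU] otherwise *)
  (hD0 : forall w, D w = 0 <-> G w = Tn.+1)
  (hDrange : forall w, (G w <= Tn)%N -> dL <= D w <= dU)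
  (* 2-MP (a), (b) *)
  (hPD0 : (0 < P (evD0 D))%E)
  (hsupp : forall g, Gs g -> (g <= Tn)%N -> forall x, dL <= x <= dU ->
     forall e, 0 < e -> (0 < P [set w | G w = g /\ (`|D w - x| < e)%R])%E)
  (hdL : 0 < dL) (hdLU : dL < dU)
  (* 3-MP (b) *)
  (hW1 : forall w, Wt G D 1 w = 0)
  (hWstag : forall t w x, (2 <= t <= Tn)%N -> x != 0 ->
     Wt G D t.-1 w = x -> Wt G D t w = x)
  (* 3-MP (a): no anticipation *)
  (hNA : forall t g a w, Gs g -> (g <= Tn)%N -> dL <= a <= dU ->
     (1 <= t)%N -> (t < g)%N -> Y t g a w = Y0 Y Tn t w)
  (* random variables with finite second moments *)
  (hmom : forall t, (1 <= t <= Tn)%N ->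
     [/\ measurable_fun [set: T] (Yobs Y G D Tn t),
         P.-integrable [set: T] (fun w => (Yobs Y G D Tn t w ^+ 2)%:E),
         measurable_fun [set: T] (Y0 Y Tn t),
         P.-integrable [set: T] (fun w => (Y0 Y Tn t w ^+ 2)%:E) &
         forall g a, Gs g -> (g <= Tn)%N -> dL <= a <= dU ->
           measurable_fun [set: T] (Y t g a) /\
           P.-integrable [set: T] (fun w => (Y t g a w ^+ 2)%:E)])
  (* kern g is the conditional law given (G = g, D = .), and the conditional
     expectations given (G = g, D = x), x in D+, are finite *)
  (hkern : forall g, Gs g -> (g <= Tn)%N -> is_cond_kernel P G D g (kern g))
  (hkint : forall g x t, Gs g -> (g <= Tn)%N -> dL <= x <= dU ->
     (1 <= t <= Tn)%N ->
     [/\ (kern g x).-integrable [set: T] (EFin \o Yobs Y G D Tn t),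
         (kern g x).-integrable [set: T] (EFin \o Y0 Y Tn t) &
         forall a, dL <= a <= dU ->
           (kern g x).-integrable [set: T] (EFin \o Y t g a)])
  (* 2-MP (c) *)
  (hC1 : forall g t, Gs g -> (g <= Tn)%N -> (2 <= t <= Tn)%N ->
     C1_on dL dU (fun x => Ex (kern g x)
                     (fun w => Yobs Y G D Tn t w - Yobs Y G D Tn t.-1 w)))
  (* 4-MP (a): parallel trends *)
  (hPT : forall g t x, Gs g -> (g <= Tn)%N -> (2 <= t <= Tn)%N ->
     dL <= x <= dU ->
     Ex (kern g x) (fun w => Y0 Y Tn t w - Y0 Y Tn t.-1 w) =
     CE P (fun w => Y0 Y Tn t w - Y0 Y Tn t.-1 w) (evD0 D)) :
  forall g k, Gs g -> Gs k -> (k <= Tn)%N -> (g < k)%N ->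
  (* differentiability of (a, b) |-> ATTbar^A(g, a | g, b) on D+ x D+ *)
  diff_on_square dL dU (ATTbar Y Tn kern (POST Tn g) g) ->
  diff_on_square dL dU (ATTbar Y Tn kern (MID g k) g) ->
  diff_on_square dL dU (ATTbar Y Tn kern (POST Tn k) g) ->
  diff_on_square dL dU (ATTbar Y Tn kern (POST Tn k) k) ->
  (* the integrals on the right-hand sides exist *)
  lebesgue_measure.-integrable `[dL, dU] (fun l =>
     (ACRTbar Y Tn kern (POST Tn g) g l + dATT_h Y Tn kern (POST Tn g) g l)%:E) ->
  lebesgue_measure.-integrable `[dL, dU] (fun l =>
     (ACRTbar Y Tn kern (MID g k) g l + dATT_h Y Tn kern (MID g k) g l)%:E) ->
  lebesgue_measure.-integrable `[dL, dU] (fun l =>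
     (ACRTbar Y Tn kern (POST Tn k) g l + dATT_h Y Tn kern (POST Tn k) g l)%:E) ->
  lebesgue_measure.-integrable `[dL, dU] (fun l =>
     (ACRTbar Y Tn kern (POST Tn k) k l + dATT_h Y Tn kern (POST Tn k) k l)%:E) ->
  [/\
   delta_WITHIN P G D (Yobs Y G D Tn) Tn g =
     Rintegral lebesgue_measure `[dL, dU] (fun l =>
       w1_within P G D g l *
       (ACRTbar Y Tn kern (POST Tn g) g l + dATT_h Y Tn kern (POST Tn g) g l)),
   delta_MID_PRE P G D (Yobs Y G D Tn) g k =
     Rintegral lebesgue_measure `[dL, dU] (fun l =>
       w1 P G D g l *
       (ACRTbar Y Tn kern (MID g k) g l + dATT_h Y Tn kern (MID g k) g l))
     + w0 P G D dL g * ATTbar Y Tn kern (MID g k) g dL dL / dL,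
   delta_POST_MID P G D (Yobs Y G D Tn) Tn g k =
     Rintegral lebesgue_measure `[dL, dU] (fun l =>
       w1 P G D k l *
       (ACRTbar Y Tn kern (POST Tn k) k l + dATT_h Y Tn kern (POST Tn k) k l))
     + w0 P G D dL k * ATTbar Y Tn kern (POST Tn k) k dL dL / dL
     - w0 P G D dL k *
       (piG P G D (Yobs Y G D Tn) (POST Tn k) (PRE g) g
        - piG P G D (Yobs Y G D Tn) (MID g k) (PRE g) g) / dL &
   CE P D (evG G g) <> CE P D (evG G k) ->
   delta_POST_PRE P G D (Yobs Y G D Tn) Tn g k =
     Rintegral lebesgue_measure `[dL, dU] (fun l =>
       w1_across P G D g k l *
       (ACRTbar Y Tn kern (POST Tn k) g l + dATT_h Y Tn kern (POST Tn k) g l))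
     - (Rintegral lebesgue_measure `[dL, dU] (fun l =>
          tw1_across P G D g k l *
          (derive1 (piD P D (Yobs Y G D Tn) kern (POST Tn k) (PRE g) k) l
           - derive1 (piD P D (Yobs Y G D Tn) kern (POST Tn k) (PRE g) g) l))
        + tw0_across P G D dL g k *
          (piD P D (Yobs Y G D Tn) kern (POST Tn k) (PRE g) k dL
           - piD P D (Yobs Y G D Tn) kern (POST Tn k) (PRE g) g dL) / dL)].
Proof.
move=> g k gS kS kT gk dF1 dF2 dF3 dF4 _ _ _ _.
have /andP[g2 _] := hGs g gS.
have gT : (g <= Tn)%N by exact: leq_trans (ltnW gk) kT.
pose Yo := Yobs Y G D Tn.
pose X (A B : nat * nat) (w : T) : R := wavg Yo A w - wavg Yo B w.
pose win (A : nat * nat) := [&& (1 <= A.1)%N, (A.1 <= A.2)%N & (A.2 <= Tn)%N].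
pose c0 t := CE P (Y0 Y Tn t) (evD0 D).
have mD0 : measurable (evD0 D).
  by have := hDmeas measurableT [set 0] (measurable_set1 _); rewrite setTI.
have mYobs t : (1 <= t <= Tn)%N -> measurable_fun [set: T] (Yobs Y G D Tn t).
  by move=> /hmom [].
have mY0 t : (1 <= t <= Tn)%N -> measurable_fun [set: T] (Y0 Y Tn t).
  by move=> /hmom [].
have iYobs t : (1 <= t <= Tn)%N -> P.-integrable [set: T] (EFin \o Yobs Y G D Tn t).
  by move=> /hmom [m2 i2 _ _ _]; exact: integrable_of_sqr.
have iY0 t : (1 <= t <= Tn)%N -> P.-integrable [set: T] (EFin \o Y0 Y Tn t).
  by move=> /hmom [_ _ m2 i2 _]; exact: integrable_of_sqr.
have meas h : Gs h -> (h <= Tn)%N -> forall m', {within `[dL, dU], continuous m'} ->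
  [/\ lebesgue_measure.-integrable `[dL, dU] (EFin \o (fun l => PDge P G D h l * m' l)),
      lebesgue_measure.-integrable `[dL, dU] (EFin \o (fun l =>
        Ex P (fun w => (D w - CE P D (evG G h)) * \1_(evGge G D h l) w) * m' l)) &
      forall l, w1_within P G D h l =
        Ex P (fun w => (D w - CE P D (evG G h)) * \1_(evGge G D h l) w) /
        Pr P (evG G h) / cvar P D (evG G h)].
  move=> hS hT m' cm'; have mG := hGmeas h.
  have Dh w : G w = h -> dL <= D w <= dU.
    by move=> Gw; apply: hDrange; rewrite Gw.
  split.
  - by eapply (integrable_PDge P G D dL dU h); eassumption.
  - set d := CE P D (evG G h).
    apply: (integrable_group_survival P G D dL dU h mG hDmeas Dh (dU + `|d|)
      (fun x => x - d)) => //.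
    + by apply: measurable_funB => //; exact: measurable_cst.
    + move=> x /andP[xl xu]; rewrite (le_trans (ler_normB _ _))// lerD2r.
      by rewrite ger0_norm// (le_trans _ xl)// ltW.
    + by rewrite addr_ge0// ltW// (lt_trans hdL hdLU).
  - by move=> l; eapply (w1_withinE P G D dL dU h); eassumption.
(* The facts about a single timing group, stated for an arbitrary treated group so that they can be
   used for both [g] and [k]. *)
have group h : Gs h -> (h <= Tn)%N ->
  [/\ Pr P (evG G h) != 0,
      (forall A B, win A -> win B ->
         C1_on dL dU (fun x => Ex (kern h x) (X A B))),
      (forall A B m', win A -> win B -> {within `[dL, dU], continuous m'} ->
         (forall x, dL < x < dU ->
            derive1 (fun x => Ex (kern h x) (X A B)) x = m' x) ->
         [/\ CE P (X A B) (evG G h) = Ex (kern h dL) (X A B) +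
               \int[lebesgue_measure]_(l in `[dL, dU]) (PDge P G D h l * m' l) &
             ccov P (X A B) D (evG G h) =
               (\int[lebesgue_measure]_(l in `[dL, dU])
                 (Ex P (fun w => (D w - CE P D (evG G h)) * \1_(evGge G D h l) w) * m' l)) /
               Pr P (evG G h)]),
      (forall A B, win A -> win B -> (A.2 < h)%N -> (B.2 < h)%N ->
         CE P (X A B) (evG G h) = avg c0 A - avg c0 B) &
      (forall A B, win A -> win B -> (h <= A.1)%N -> (B.2 < h)%N ->
         diff_on_square dL dU (ATTbar Y Tn kern A h) ->
         Ex (kern h dL) (X A B) = ATTbar Y Tn kern A h dL dL + (avg c0 A - avg c0 B) /\
         forall x, dL < x < dU ->
           derive1 (fun x => Ex (kern h x) (X A B)) x =
           ACRTbar Y Tn kern A h x + dATT_h Y Tn kern A h x)].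
  move=> hS hT.
  have mG := hGmeas h.
  have Dh w : G w = h -> dL <= D w <= dU.
    by move=> Gw; apply: hDrange; rewrite Gw.
  have supp := hsupp h hS hT.
  have mY t a : (1 <= t <= Tn)%N -> dL <= a <= dU -> measurable_fun [set: T] (Y t h a).
    by move=> /hmom [_ _ _ _ H] aab; have [] := H h a hS hT aab.
  have hk := hkern h hS hT.
  have kYobs x t : dL <= x <= dU -> (1 <= t <= Tn)%N ->
      (kern h x).-integrable [set: T] (EFin \o Yobs Y G D Tn t).
    by move=> xab tn; have [] := hkint h x t hS hT xab tn.
  have kY0 x t : dL <= x <= dU -> (1 <= t <= Tn)%N ->
      (kern h x).-integrable [set: T] (EFin \o Y0 Y Tn t).
    by move=> xab tn; have [] := hkint h x t hS hT xab tn.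
  have kY x t a : dL <= x <= dU -> (1 <= t <= Tn)%N -> dL <= a <= dU ->
      (kern h x).-integrable [set: T] (EFin \o Y t h a).
    by move=> xab tn; have [_ _] := hkint h x t hS hT xab tn; exact.
  have C1h t : (2 <= t <= Tn)%N -> C1_on dL dU (fun x => Ex (kern h x)
      (fun w => Yobs Y G D Tn t w - Yobs Y G D Tn t.-1 w)).
    exact: hC1.
  have PTh t x : (2 <= t <= Tn)%N -> dL <= x <= dU ->
      Ex (kern h x) (fun w => Y0 Y Tn t w - Y0 Y Tn t.-1 w) = c0 t - c0 t.-1.
    (* Parallel trends involves the mean of a change; splitting it exhibits the right side as an
       increment of the path [c0]. *)
    move=> tn xab; rewrite (hPT h t x)//; move: tn => /andP[t2 tn].
    apply: CEB => //; apply: iY0; first by rewrite tn (ltnW t2).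
    by case: t t2 tn => [|[|t]]//= _ /ltnW ->.
  split.
  - by eapply (Pr_group_neq0 P G D dL dU h); eassumption.
  - by move=> A B wA wB; eapply (C1_window_diff Tn G D dL dU Y kern h); eassumption.
  - move=> A B m' wA wB cm' dm; split.
      by eapply (window_diff_CE P Tn G D dL dU Y kern h); eassumption.
    by eapply (window_diff_ccov P Tn G D dL dU Y kern h); eassumption.
  - move=> A B wA wB Ah Bh.
    by eapply (pretreatment_CE P Tn G D dL dU Y kern h); eassumption.
  - move=> A B wA wB Ah Bh dF; split.
      have dLin : dL <= dL <= dU by rewrite lexx ltW.
      by eapply (posttreatment_window_diff P Tn G D dL dU Y kern h); eassumption.
    move=> x xab.
    by eapply (derive1_window_diff P Tn G D dL dU Y kern h); eassumption.
have [nzg C1g formg _ postg] := group g gS gT.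
have [nzk C1k formk prek postk] := group k kS kT.
have measg := meas g gS gT; have meask := meas k kS kT.
have g0 : (0 < g)%N by exact: ltnW.
have k0 : (0 < k)%N by exact: ltn_trans gk.
have wPg : win (POST Tn g) by apply/and3P.
have wPk : win (POST Tn k) by apply/and3P.
(* The pre-treatment window is nonempty because timing groups start at period 2. *)
have wR : win (PRE g).
  apply/and3P; split=> //=; first by rewrite -ltnS prednK.
  exact: leq_trans (leq_pred g) gT.
have wM : win (MID g k).
  apply/and3P; split=> //=; first by rewrite -ltnS prednK.
  exact: leq_trans (leq_pred k) kT.
have Rg : ((PRE g).2 < g)%N by rewrite /= ltn_predL.
have Rk : ((PRE g).2 < k)%N by exact: leq_ltn_trans (leq_pred g) gk.
have Mk : ((MID g k).2 < k)%N by rewrite /= ltn_predL.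
have CE0 A B : win A -> win B -> CE P (X A B) (evD0 D) = avg c0 A - avg c0 B.
  move=> /and3P[A1 A12 An] /and3P[B1 B12 Bn].
  by apply: (never_treated_means P Tn G D Y A B) => //; apply/andP.
have CEg A B : win A -> win B -> CE P (X A B) (evG G g) =
    avg (fun t => CE P (Yo t) (evG G g)) A - avg (fun t => CE P (Yo t) (evG G g)) B.
  move=> /and3P[A1 A12 An] /and3P[B1 B12 Bn]; apply: CE_wavgB => // t /andP[t1 t2].
    by apply: iYobs; rewrite (leq_trans A1 t1) (leq_trans t2 An).
  by apply: iYobs; rewrite (leq_trans B1 t1) (leq_trans t2 Bn).
have dL0 : dL != 0 by rewrite gt_eqF.
(* The dose [dL] in [w0] cancels the division of the effect by [dL], leaving the effect over the
   mean dose. *)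
have w0E (x a : R) : dL / x * a / dL = a / x.
  transitivity (dL * dL^-1 * (a / x)); first by ring.
  by rewrite mulfV// mul1r.
split.
(* Within comparison: covariance and weight share the centred survival expectation, and the common
   factor is the inverse of group probability times variance. *)
- have [_ [_ [m' [cm' dm]]]] := C1g _ _ wPg wR.
  have [_ cov] := formg _ _ m' wPg wR cm' dm.
  have [_ acrt] := postg _ _ wPg wR (leqnn g) Rg dF1.
  have [_ iS w1E] := measg m' cm'.
  rewrite /delta_WITHIN [X in X / _]cov -mulrA; apply/esym.
  apply: Rintegral_eq_ooZr iS => l lab.
  by rewrite -acrt// dm// w1E; ring.
(* Group [k] is untreated in both windows, so its change is the never-treated trend and cancels the
   trend in the change of [g]. *)
- have [_ [_ [m' [cm' dm]]]] := C1g _ _ wM wR.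
  have [ce _] := formg _ _ m' wM wR cm' dm.
  have [att acrt] := postg _ _ wM wR (leqnn g) Rg dF2.
  have [iS _ _] := measg m' cm'.
  rewrite /delta_MID_PRE [X in (X - _) / _]ce [X in (_ - X) / _](prek _ _ wM wR Mk Rk) att.
  rewrite [in RHS](Rintegral_eq_ooZr _ _ (CE P D (evG G g))^-1 _ _ _ iS); last first.
    by move=> l lab; rewrite -acrt// dm// /w1; ring.
  by rewrite /w0 w0E; ring.
(* Group [g] is already treated in both windows, so its change exceeds the never-treated trend by
   the difference of the two [piG] terms, in which the averages over [PRE g] cancel. *)
- have [_ [_ [m' [cm' dm]]]] := C1k _ _ wPk wM.
  have [ce _] := formk _ _ m' wPk wM cm' dm.
  have [att acrt] := postk _ _ wPk wM (leqnn k) Mk dF4.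
  have [iS _ _] := meask m' cm'.
  have pE A : win A -> piG P G D Yo A (PRE g) g =
      avg (fun t => CE P (Yo t) (evG G g)) A - avg (fun t => CE P (Yo t) (evG G g)) (PRE g)
      - (avg c0 A - avg c0 (PRE g)).
    by move=> wA; rewrite /piG [X in X - _]CEg// [X in _ - X]CE0.
  rewrite /delta_POST_MID [X in (X - _) / _]ce [X in (_ - X) / _](CEg _ _ wPk wM) att.
  rewrite [in RHS](Rintegral_eq_ooZr _ _ (CE P D (evG G k))^-1 _ _ _ iS); last first.
    by move=> l lab; rewrite -acrt// dm// /w1; ring.
  by rewrite /w0 !w0E !pE//; ring.
- move=> _.
  (* Both groups change treatment status here. With S for survival probabilities, S_g mg - S_k mk =
     (S_g - S_k) mg - S_k (mk - mg): the first part carries the causal derivatives of [g], the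
     second the difference of the [piD] derivatives. *)
  have [_ [_ [mg [cmg dmg]]]] := C1g _ _ wPk wR.
  have [_ [_ [mk [cmk dmk]]]] := C1k _ _ wPk wR.
  have [ceg _] := formg _ _ mg wPk wR cmg dmg.
  have [cek _] := formk _ _ mk wPk wR cmk dmk.
  have [_ acrt] := postg _ _ wPk wR (ltnW gk) Rg dF3.
  have [igg _ _] := measg mg cmg; have [ikg _ _] := meask mg cmg.
  have [ikk _ _] := meask mk cmk.
  set Dlt := CE P D (evG G g) - CE P D (evG G k).
  have igkg : lebesgue_measure.-integrable `[dL, dU]
      (EFin \o (fun l => PDge P G D g l * mg l - PDge P G D k l * mg l)).
    by apply: (integrableB _ igg ikg).
  have ikkg : lebesgue_measure.-integrable `[dL, dU]
      (EFin \o (fun l => PDge P G D k l * mk l - PDge P G D k l * mg l)).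
    by apply: (integrableB _ ikk ikg).
  rewrite [X in _ = X - _](Rintegral_eq_ooZr _ _ Dlt^-1 _ _ _ igkg); last first.
    by move=> l lab; rewrite -acrt// dmg// /w1_across; ring.
  rewrite [X in _ = _ - (X + _)](Rintegral_eq_ooZr _ _ Dlt^-1 _ _ _ ikkg); last first.
    move=> l lab; rewrite /piD !derive1_subc /tw1_across.
    by rewrite [X in _ * (X - _)]dmk// [X in _ * (_ - X)]dmg//; ring.
  rewrite !RintegralB//.
  rewrite /delta_POST_PRE [X in (X - _) / _]ceg [X in (_ - X) / _]cek.
  by rewrite /tw0_across w0E /piD; ring.
Qed.
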